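(* Let $G$ be a compact abelian group with normalized Haar measure $\mu$ and dual group $\Gamma$, and let $F=\{\gamma_n\}_{n=1}^\infty\subset\Gamma$ be an infinite Sidon set of distinct characters. Then $\{\gamma_n\}$, viewed as random variables on $(G,\mu)$, is equivalent in distribution to the Rademacher system (with real coefficients $a_n$ and $|\cdot|$ denoting the modulus), and the constant of this equivalence depends only on the Sidon constant $C(F)$.
   Context: For $F\subset\Gamma$, $C_F(G)$ is the set of continuous $f$ on $G$ with $\hat f(\gamma)=\int_G f\bar\gamma\,d\mu=0$ for $\gamma\notin F$. $F$ is a Sidon set if there is $C(F)$ with $\sum_{\gamma\in\Gamma}|\hat f(\gamma)|\le C(F)\|f\|_\infty$ for all $f\in C_F(G)$. The Rademacher system is $r_n(x)=\operatorname{sign}\sin(2^{n-1}\pi x)$ on $[0,1]$ with Lebesgue measure $|\cdot|$. Equivalence in distribution of $\{f_n\}$ and $\{g_n\}$: there is $C>0$ such that for all $m$, real $a_1,\dots,a_m$ and $z>0$, $C^{-1}\mathbb P\{|\sum_{n=1}^m a_nf_n|>Cz\}\le\mathbb P'\{|\sum_{n=1}^m a_ng_n|>z\}\le C\,\mathbb P\{|\sum_{n=1}^m a_nf_n|>C^{-1}z\}$. *)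

(* Defs.v *)
From HB Require Import structures.
From mathcomp Require Import all_boot all_order all_algebra.
From mathcomp Require Import all_classical all_reals all_analysis.
From mathcomp Require Import complex.
Set Implicit Arguments. Unset Strict Implicit. Unset Printing Implicit Defensive.
Import Order.TTheory GRing.Theory Num.Theory numFieldNormedType.Exports.
Local Open Scope classical_set_scope.
Local Open Scope ring_scope.

(* The Borel sigma-algebra of a topological abelian group G:
   borelG G is G (as a type) equipped with the sigma-algebra generated by
   the open sets of G. *)
Definition borelG (G : topologicalZmodType) : Type := G.

Section borel_instance.
Variable G : topologicalZmodType.
HB.instance Definition _ := Choice.on (borelG G).
HB.instance Definition _ := isPointed.Build (borelG G) (0%R : G).
Lemma borelG_measurableC (A : set G) :
  <<s @open G >> A -> <<s @open G >> (~` A).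
Proof. by move=> sGA; rewrite -setTD; exact: sigma_algebraCD. Qed.
HB.instance Definition _ := @isMeasurable.Build (sigma_display (@open G))
  (borelG G) <<s @open G >> (@sigma_algebra0 _ setT (@open G))
  borelG_measurableC (@sigma_algebra_bigcup _ setT (@open G)).
End borel_instance.

Section Defs.
Context {R : realType} {G : topologicalZmodType}.
Implicit Types (mu : {measure set borelG G -> \bar R}) (f g : G -> R[i]).

(* normalized Haar measure on a compact (Hausdorff) abelian group:
   a translation-invariant, (outer) regular Borel probability measure *)
Definition is_normalized_haar mu :=
  [/\ mu [set: G] = 1%E,
      (forall (x : G) (A : set G), (measurable : set (set (borelG G))) A ->
         mu [set x + y | y in A] = mu A) &
      (forall A : set G, (measurable : set (set (borelG G))) A ->
         mu A = ereal_inf [set mu U | U in [set U : set G | open U /\ A `<=` U]])].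

(* continuity of a complex-valued function (componentwise) *)
Definition ccontinuous f :=
  continuous (fun x => complex.Re (f x)) /\ continuous (fun x => complex.Im (f x)).

(* continuous characters of G; the dual group Gamma is the set of them *)
Definition is_character f :=
  [/\ ccontinuous f,
      (forall x y : G, f (x + y) = f x * f y) &
      (forall x : G, Normc.normc (f x) = 1)].

Definition dual_group : set (G -> R[i]) := [set g | is_character g].

(* integral over G of a complex-valued function (real and imaginary parts) *)
Definition cintegral mu f : R[i] :=
  Complex (Rintegral mu setT (fun x => complex.Re (f x)))
          (Rintegral mu setT (fun x => complex.Im (f x))).

(* Fourier coefficient  \hat f(gamma) = \int_G f \bar gamma d mu *)
Definition fourier mu f g : R[i] := cintegral mu (fun x => f x * (g x)^*)%C.

(* C_F(G) *)
Definition C_F mu (F : set (G -> R[i])) f :=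
  ccontinuous f /\
  forall g, is_character g -> ~ F g -> fourier mu f g = 0.

(* sup norm *)
Definition supnorm f : R := sup [set Normc.normc (f x) | x in [set: G]].

(* F is a Sidon set with constant K *)
Definition is_Sidon mu (F : set (G -> R[i])) (K : R) :=
  forall f, C_F mu F f ->
    (\esum_(g in dual_group) (Normc.normc (fourier mu f g))%:E
       <= (K * supnorm f)%:E)%E.

End Defs.

(* Rademacher functions, 0-indexed: rademacher n = r_{n+1},
   r_{n+1}(x) = sign sin(2^n pi x) *)
Definition rademacher {R : realType} (n : nat) (x : R) : R :=
  Num.sg (sin (2 ^+ n * pi * x)).

(* {gam n} on (G, mu) is equivalent in distribution to the Rademacher system
   (on [0,1] with Lebesgue measure), with constant C *)
Definition equiv_rademacher {R : realType} {G : topologicalZmodType}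
  (mu : {measure set borelG G -> \bar R}) (gam : nat -> G -> R[i]) (C : R) :=
  0 < C /\
  forall (m : nat) (a : nat -> R) (z : R), 0 < z ->
    (C^-1%:E * mu [set x : G |
        (C * z < Normc.normc (\sum_(n < m) ((a n)%:C)%C * gam n x))%R]
     <= (@lebesgue_measure R) [set t : R | (0 <= t <= 1)%R /\
        (z < `|\sum_(n < m) a n * rademacher n t|)%R]
     /\
     (@lebesgue_measure R) [set t : R | (0 <= t <= 1)%R /\
        (z < `|\sum_(n < m) a n * rademacher n t|)%R]
     <= C%:E * mu [set x : G |
        (C^-1 * z < Normc.normc (\sum_(n < m) ((a n)%:C)%C * gam n x))%R])%E.

(* Main.v *)
Require Import Defs.
From HB Require Import structures.
From mathcomp Require Import all_boot all_order all_algebra.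
From mathcomp Require Import ring lra.
From mathcomp Require Import all_classical all_reals all_analysis.
From mathcomp Require Import measurable_realfun.
From mathcomp Require Import complex.
Import Order.TTheory GRing.Theory Num.Theory numFieldNormedType.Exports.
Local Open Scope classical_set_scope.
Local Open Scope ring_scope.
Set Implicit Arguments.
Unset Strict Implicit.
Unset Printing Implicit Defensive.

(** Write X for a real Rademacher sum and Y for the modulus of the
    corresponding sum of characters.  By the Sidon inequality and a convexity
    argument, multiplying the coefficients of a trigonometric polynomial by
    signs changes its L^2k norm by at most a factor 4K, for every k >= 1.
    Averaging over the signs and using |gamma_n| = 1, the even moments
    of X and Y are comparable: E Y^2k and E X^2k agree up to (8K)^2k.
    Moreover E X^4k <= 2^4k (E X^2k)^2, since E X^2k / (2k)! is
    submultiplicative in k.  Hence both tails are governed by the moments: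
    Chebyshev's inequality at exponent 2k = 2^(j+1) bounds one tail from above
    by B^-4k, Paley-Zygmund bounds the other from below by B^-4k / 4 at a
    comparable level, and j is chosen according to z. *)

(** * Rademacher averages *)

(** The convexity argument is duality in finite form. Replacing each coefficient [a n] by
    [a n * gam n x] translates the polynomial and so leaves its moments unchanged. Read dually, the
    Sidon inequality says that the convex hull of the sequences [2 * K * c * gam n x], with [c] in
    the unit disc, comes arbitrarily close to every sequence bounded by 1, in particular to all
    signs. The factor 4K is K times two 2's: one for choosing a point where a polynomial reaches
    half of what the Sidon inequality predicts, one for absorbing the approximation error. The last
    2 in 8K comes from the real and imaginary parts of the characters. Comparable moments alone do
    not bound a tail from below: the moment of order 4k must be controlled by that of order 2k, for
    both variables. For Y this is inherited from X through the comparison. All constants have the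
    form c^2k with c independent of k and of the number of terms, so they become rescalings of z. *)

Section SignMean.
Variable R : realFieldType.
Implicit Types (F G : seq R -> R) (a b : nat -> R).

(** Expectation over [m] independent fair signs, by conditioning on the first one. This recursion
    matches both the expansion of moments in [a 0] and the halving of dyadic intervals. *)
Fixpoint sgn_mean m F : R :=
  if m is n.+1 then
    (sgn_mean n (fun s => F (1 :: s)) + sgn_mean n (fun s => F (-1 :: s))) / 2
  else F [::].

Definition signs (s : seq R) := all (mem [:: 1; -1]) s.

Lemma signs_sqr s i : signs s -> (i < size s)%N -> s`_i ^+ 2 = 1.
Proof.
move=> /allP ss si; have := ss _ (mem_nth 0 si).
by rewrite !inE => /orP[] /eqP ->; rewrite ?sqrrN expr1n.
Qed.

Lemma le_sgn_mean m F G :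
  (forall s, size s = m -> signs s -> F s <= G s) ->
  sgn_mean m F <= sgn_mean m G.
Proof.
elim: m F G => [|m IH] F G FG /=; first exact: FG.
rewrite ler_pM2r ?invr_gt0 ?ltr0n // lerD //; apply: IH => s sm ss; apply: FG;
  by rewrite /= ?sm // !inE eqxx ?orbT.
Qed.

Lemma eq_sgn_mean m F G :
  (forall s, size s = m -> signs s -> F s = G s) ->
  sgn_mean m F = sgn_mean m G.
Proof.
by move=> FG; apply/eqP; rewrite eq_le !le_sgn_mean // => s sm ss;
  rewrite FG.
Qed.

Lemma sgn_meanD m F G :
  sgn_mean m (fun s => F s + G s) = sgn_mean m F + sgn_mean m G.
Proof. by elim: m F G => [|m IH] F G //=; rewrite !IH; ring. Qed.

Lemma sgn_meanZ m c F : sgn_mean m (fun s => c * F s) = c * sgn_mean m F.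
Proof. by elim: m F => [|m IH] F //=; rewrite !IH; ring. Qed.

Lemma sgn_mean_cst m c : sgn_mean m (fun=> c) = c.
Proof. by elim: m => [|m /= ->] //; field. Qed.

Lemma sgn_mean_sum m n (F : nat -> seq R -> R) :
  sgn_mean m (fun s => \sum_(i < n) F i s) = \sum_(i < n) sgn_mean m (F i).
Proof.
elim: n => [|n IH].
  by rewrite big_ord0 -[RHS](sgn_mean_cst m); apply: eq_sgn_mean => s _ _;
    rewrite big_ord0.
rewrite big_ord_recr /= -IH -sgn_meanD; apply: eq_sgn_mean => s _ _.
by rewrite big_ord_recr.
Qed.

Lemma sgn_mean_opp m F : sgn_mean m (fun s => F (map -%R s)) = sgn_mean m F.
Proof.
elim: m F => [|m IH] F //=.
rewrite (IH (fun s => F (- 1 :: s))) (IH (fun s => F (- - 1 :: s))).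
by rewrite addrC opprK.
Qed.

Definition rsum a m (s : seq R) : R := \sum_(i < m) a i * s`_i.

Definition rmom a m k : R := sgn_mean m (fun s => rsum a m s ^+ (2 * k)).

Lemma rsum_cons a m x s :
  rsum a m.+1 (x :: s) = a 0%N * x + rsum (a \o succn) m s.
Proof. by rewrite /rsum big_ord_recl. Qed.

Lemma rsum_opp a m s : size s = m -> rsum a m (map -%R s) = - rsum a m s.
Proof.
move=> sm; rewrite /rsum -sumrN; apply: eq_bigr => i _.
by rewrite (nth_map 0) ?sm // mulrN.
Qed.

Lemma rmom_ge0 a m k : 0 <= rmom a m k.
Proof.
rewrite -(sgn_mean_cst m 0); apply: le_sgn_mean => s _ _.
by rewrite exprM exprn_ge0 ?sqr_ge0.
Qed.

Lemma sum_even k (f : nat -> R) : (forall i, odd i -> f i = 0) ->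
  \sum_(i < (2 * k).+1) f i = \sum_(j < k.+1) f (2 * j)%N.
Proof.
move=> f0; elim: k => [|k IH]; first by rewrite !big_ord_recr !big_ord0.
rewrite [RHS]big_ord_recr /= -IH mulnS add2n big_ord_recr big_ord_recr /=.
by rewrite [f (2 * k).+1]f0 ?addr0 //= oddM.
Qed.

Lemma exprD_sym k (x y : R) :
  ((x + y) ^+ (2 * k) + (- x + y) ^+ (2 * k)) / 2 =
  \sum_(j < k.+1) 'C(2 * k, 2 * j)%:R * x ^+ (2 * j) * y ^+ (2 * (k - j)).
Proof.
(* The factor [(1 + (-1) ^+ i) / 2] is 1 for even [i] and 0 for odd [i]. *)
pose f i := (1 + (-1) ^+ i) / 2 * ('C(2 * k, i)%:R * x ^+ i * y ^+ (2 * k - i)).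
transitivity (\sum_(i < (2 * k).+1) f i).
  rewrite ![_ + y]addrC !exprDn -big_split mulr_suml /=; apply: eq_bigr => i _.
  rewrite /f [(- x) ^+ i]exprNn -[_ * (_ * _) *+ _]mulr_natl -[_ * x ^+ i *+ _]mulr_natl.
  move: (y ^+ _) (x ^+ _) ((-1) ^+ _) ('C(_, _)%:R) => u v w c.
  by field.
rewrite sum_even => [|i oi]; last by rewrite /f -signr_odd oi expr1 subrr !mul0r.
apply: eq_bigr => j _; rewrite /f exprM sqrrN expr1n expr1n mulnBr.
by rewrite -[1 + 1]/(2%:R) divff ?pnatr_eq0 // mul1r.
Qed.

(** Conditioning on the first sign kills the odd powers of [a 0]. All remaining terms are
    nonnegative, and the monotonicity and submultiplicativity of moments rest on this. *)
Lemma rmomS a m k : rmom a m.+1 k =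
  \sum_(j < k.+1) 'C(2 * k, 2 * j)%:R * a 0%N ^+ (2 * j) *
    rmom (a \o succn) m (k - j).
Proof.
rewrite /rmom /= -sgn_meanD mulrC -sgn_meanZ.
pose F (j : nat) s := 'C(2 * k, 2 * j)%:R * a 0%N ^+ (2 * j) *
  rsum (a \o succn) m s ^+ (2 * (k - j)).
transitivity (sgn_mean m (fun s => \sum_(j < k.+1) F j s)).
  apply: eq_sgn_mean => s _ _; rewrite !rsum_cons mulr1 mulrN1 mulrC.
  exact: exprD_sym.
by rewrite sgn_mean_sum; apply: eq_bigr => j _; rewrite sgn_meanZ.
Qed.

(** Contraction principle for even moments: [rmomS] involves the coefficients only through their
    squares, with nonnegative weights. *)
Lemma le_rmom a b m k : (forall i, (i < m)%N -> a i ^+ 2 <= b i ^+ 2) ->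
  rmom a m k <= rmom b m k.
Proof.
elim: m a b k => [|m IH] a b k ab.
  by rewrite /rmom /= /rsum !big_ord0.
rewrite !rmomS; apply: ler_sum => j _; apply: ler_pM.
- by rewrite mulr_ge0 // ?ler0n // exprM exprn_ge0 ?sqr_ge0.
- exact: rmom_ge0.
- by apply: ler_wpM2l; rewrite ?ler0n // !exprM lerXn2r ?nnegrE ?sqr_ge0 ?ab.
- by apply: IH => i im; apply: ab.
Qed.

(** The sum is cut after [i = k]. The first part is dominated by the products with the term 0 of the
    second factor, the rest by the products of the term [k] of the first factor with the later terms
    of the second. No product is used twice. *)
Lemma convolution_submul (g h : nat -> R) k l :
  (forall i, 0 <= g i) -> (forall i, 0 <= h i) ->
  (forall i j, g (i + j)%N <= g i * g j) ->
  (forall i j, h (i + j)%N <= h i * h j) ->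
  \sum_(i < (k + l).+1) g i * h (k + l - i)%N <=
  (\sum_(i < k.+1) g i * h (k - i)%N) * (\sum_(i < l.+1) g i * h (l - i)%N).
Proof.
move=> g0 h0 gM hM; rewrite -addSn.
rewrite big_split_ord /=.
rewrite [X in _ <= _ * X]big_ord_recl mulrDr /=; apply: lerD.
  rewrite mulr_suml; apply: ler_sum => i _; rewrite mulrACA subn0.
  apply: ler_pM => //; first by rewrite -{1}[i : nat]addn0.
  by rewrite -addnBAC // -ltnS.
apply: le_trans (_ : (g k * h 0%N) * \sum_(i < l) g (bump 0 i) *
  h (l - bump 0 i)%N <= _).
  rewrite mulr_sumr; apply: ler_sum => i _; rewrite mulrACA.
  apply: ler_pM => //; first by rewrite addSnnS.
  by rewrite addSnnS subnDl; apply: (hM 0%N).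
rewrite ler_wpM2r //; first by apply: sumr_ge0 => i _; apply: mulr_ge0.
rewrite big_ord_recr /= subnn lerDr.
by apply: sumr_ge0 => i _; apply: mulr_ge0.
Qed.

(** Taylor coefficients in t^2 of E cosh(tX), which is the product of the cosh(a_i t); one more
    summand is a convolution with the coefficients of one cosh. *)
Let nmom a m k := rmom a m k / (2 * k)`!%:R.

Lemma fact_gt0r n : 0 < n`!%:R :> R.
Proof. by rewrite ltr0n fact_gt0. Qed.

Lemma nmomS a m k : nmom a m.+1 k =
  \sum_(j < k.+1) a 0%N ^+ (2 * j) / (2 * j)`!%:R * nmom (a \o succn) m (k - j).
Proof.
rewrite /nmom rmomS mulr_suml; apply: eq_bigr => j _.
have := bin_fact (leq_mul (leqnn 2) (leq_ord j)).
rewrite -mulnBr => <-; rewrite !natrM.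
have := fact_gt0r (2 * j); have := fact_gt0r (2 * (k - j)).
have : 0 < 'C(2 * k, 2 * j)%:R :> R.
  by rewrite ltr0n bin_gt0 leq_mul2l /= leq_ord.
by move=> x0 y0 z0; field; rewrite !gt_eqF.
Qed.

Lemma nmom_submul a m k l : nmom a m (k + l) <= nmom a m k * nmom a m l.
Proof.
elim: m a k l => [|m IH] a k l.
  rewrite /nmom /rmom /= /rsum big_ord0.
  case: k => [|k]; first by rewrite add0n muln0 fact0 expr0 divr1 mul1r.
  by rewrite addSn !mulnS !expr0n /= !mul0r.
rewrite !nmomS.
apply: (convolution_submul (g := fun j => a 0%N ^+ (2 * j) / (2 * j)`!%:R)
  (h := nmom (a \o succn) m)) => [i|i|i j|i j].
- by rewrite divr_ge0 ?ler0n // exprM exprn_ge0 ?sqr_ge0.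
- by rewrite divr_ge0 ?ler0n ?rmom_ge0.
- rewrite mulrACA -exprD -mulnDr ler_wpM2l //.
    by rewrite exprM exprn_ge0 ?sqr_ge0.
  (* This reduces to (2i)! (2j)! <= (2(i + j))!, that is, to a binomial coefficient being at least
     1. *)
  rewrite -invfM lef_pV2 ?posrE ?mulr_gt0 ?fact_gt0r // -natrM ler_nat.
  rewrite mulnDr -(bin_fact (leq_addr (2 * j) (2 * i))) addKn.
  by rewrite leq_pmull // bin_gt0 leq_addr.
- exact: IH.
Qed.

Lemma leq_bin_exp2 n k : ('C(n, k) <= 2 ^ n)%N.
Proof.
have [nk|kn] := ltnP n k; first by rewrite bin_small.
rewrite -[2%N]/(1 + 1)%N expnDn (bigD1 (inord k)) //= inordK //.
by rewrite !exp1n !muln1 leq_addr.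
Qed.

(** With both indices equal to [k] in [nmom_submul], the factorials combine into the binomial
    coefficient of 4k over 2k, at most 2^4k. *)
Lemma rmom_double a m k :
  rmom a m (k + k) <= 2 ^+ (4 * k) * rmom a m k ^+ 2.
Proof.
have := nmom_submul a m k k; rewrite /nmom ler_pdivrMr ?fact_gt0r //.
move/le_trans; apply.
have -> : (4 * k = 2 * (k + k))%N by rewrite addnn -mul2n mulnA.
have -> : rmom a m k / (2 * k)`!%:R * (rmom a m k / (2 * k)`!%:R) *
    (2 * (k + k))`!%:R = 'C(2 * (k + k), 2 * k)%:R * rmom a m k ^+ 2.
  rewrite mulnDr -(bin_fact (leq_addr (2 * k) (2 * k))) addKn !natrM.
  by have := fact_gt0r (2 * k) => x0; field; rewrite gt_eqF.
by rewrite ler_wpM2r ?sqr_ge0 // -natrX ler_nat leq_bin_exp2.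
Qed.

End SignMean.

(** * From moments to tails *)

Section TailMoment.
Variable R : realType.

(** [P] stands for the tail of a nonnegative random variable and [M k] for its moment of order 2k.
    The fourth clause is Chebyshev's inequality, the fifth is Paley-Zygmund with its parameter [s]
    left free, which avoids dividing by a possibly zero moment. *)
Definition tail_moment (P : R -> R) (M : nat -> R) :=
  [/\ forall z, 0 <= P z <= 1,
      {homo P : x y /~ x <= y},
      forall k, 0 <= M k,
      forall k z, 0 <= z -> z ^+ (2 * k) * P z <= M k &
      forall k z s, 0 <= z -> 0 <= s -> 2 * z ^+ (2 * k) <= M k ->
        s * M k - s ^+ 2 * M (k + k)%N <= P z].

(* For a random [y] and the event [b = (t < y)], taking expectations and
   optimizing [s] gives the Paley-Zygmund inequality. *)
Lemma paley_zygmund_pointwise (s t y : R) (b : bool) : 0 <= s -> 0 <= t ->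
  (t < y -> b) -> 0 <= y -> 2 * s * y - 2 * s * t - s ^+ 2 * y ^+ 2 <= b%:R.
Proof.
move=> s0 t0 tyb y0; apply: (@le_trans _ _ ((t < y)%R%:R)); last first.
  by case: (t < y)%R tyb => [->|_] //; rewrite ler0n.
have := sqr_ge0 (1 - s * y); have := mulr_ge0 s0 t0.
have := sqr_ge0 (s * y).
case: ltP => ty /=; first by move=> *; nra.
by have := ler_wpM2l s0 ty; nra.
Qed.

Section Expectation.
Variables (T : Type) (L : (T -> R) -> Prop) (E : (T -> R) -> R).
Hypothesis LD : forall F G, L F -> L G -> L (fun x => F x + G x).
Hypothesis ED : forall F G, L F -> L G -> E (fun x => F x + G x) = E F + E G.
Hypothesis LZ : forall c F, L F -> L (fun x => c * F x).
Hypothesis EZ : forall c F, L F -> E (fun x => c * F x) = c * E F.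
Hypothesis Lc : forall c, L (fun=> c).
Hypothesis Ec : forall c, E (fun=> c) = c.
Hypothesis Ele : forall F G, L F -> L G -> (forall x, F x <= G x) -> E F <= E G.
Variable X : T -> R.
Hypothesis X0 : forall x, 0 <= X x.
Hypothesis LX : forall n, L (fun x => X x ^+ n).
Hypothesis LI : forall z, L (fun x => (z < X x)%R%:R).

(** [E] is any normalized positive linear functional on a class [L] of functions, so one proof
    serves the finite average over signs and the Haar integral. *)
Lemma tail_moment_expectation :
  tail_moment (fun z => E (fun x => (z < X x)%R%:R))
    (fun k => E (fun x => X x ^+ (2 * k))).
Proof.
split.
- move=> z; apply/andP; split; [rewrite -[leLHS](Ec 0)|rewrite -[leRHS](Ec 1)];
    by apply: Ele => // x; case: ltP.
- move=> x y xy; apply: Ele => // t; rewrite ler_nat; case: (ltP x) => //.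
  by move/(le_lt_trans xy) => ->.
- by move=> k; rewrite -[leLHS](Ec 0); apply: Ele => // x; rewrite exprn_ge0.
- move=> k z z0; rewrite -EZ //; apply: Ele; [exact: LZ | exact: LX |].
  move=> x; case: ltP => zx; last by rewrite mulr0 exprn_ge0.
  by rewrite mulr1 lerXn2r ?nnegrE // ltW.
- move=> k z s z0 s0 zM.
  (* [G] is the pointwise Paley-Zygmund bound for [X x ^+ (2 * k)] at level [z ^+ (2 * k)]; the
     assumption on [z] lets half of [2 * s * M k] pay for the constant term. *)
  pose G x := 2 * s * X x ^+ (2 * k) + (- s ^+ 2 * X x ^+ (2 * (k + k)) +
    - (2 * s * z ^+ (2 * k))).
  have L1 : L (fun x => 2 * s * X x ^+ (2 * k)) by apply: LZ.
  have L2 : L (fun x => - s ^+ 2 * X x ^+ (2 * (k + k))) by apply: LZ.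
  have L3 : L (fun=> - (2 * s * z ^+ (2 * k))) by apply: Lc.
  have L23 := LD L2 L3.
  have LG : L G by apply: LD L23.
  apply: (@le_trans _ _ (E G)).
    rewrite /G (ED L1 L23) (ED L2 L3) !EZ // Ec.
    by have := ler_wpM2l s0 zM; nra.
  apply: Ele => // x; have := @paley_zygmund_pointwise s (z ^+ (2 * k))
    (X x ^+ (2 * k)) (z < X x)%R s0.
  rewrite /G mulnDr exprD => /(_ _ _ _)/le_trans H; apply: le_trans (H _ _ _ _ _).
  + by move: (X x ^+ _) (z ^+ _) => y t; lra.
  + exact: exprn_ge0.
  + by apply: contraTT; rewrite -!leNgt => xz; rewrite lerXn2r ?nnegrE.
  + exact: exprn_ge0.
  + exact: lexx.
Qed.

End Expectation.

Lemma ler_natr_expr (B : R) n k : 2 <= B -> (n <= k)%N -> n%:R <= B ^+ k.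
Proof.
move=> B2 nk; apply: (@le_trans _ _ (2 ^+ k)).
  by rewrite -natrX ler_nat (leq_trans nk) // ltnW // ltn_expl.
by rewrite lerXn2r ?nnegrE ?ler0n // (le_trans _ B2).
Qed.

Lemma tail_compare PX MX PY MY (A B : R) :
  tail_moment PX MX -> tail_moment PY MY -> 1 <= A -> 2 <= B ->
  (forall k, (0 < k)%N -> MY k <= A ^+ (2 * k) * MX k) ->
  (forall k, (0 < k)%N -> MX (k + k)%N <= B ^+ (4 * k) * MX k ^+ 2) ->
  forall z C, 0 < z -> C = 4 * B ^+ 4 + 2 * A * B ^+ 3 ->
    PY z <= C * PX (z / C).
Proof.
move=> [PX01 PXle MX0 _ PXpz] [PY01 _ MY0 PYmk _] A1 B2 YX XX z C z0 CE.
have B0 : 0 < B by lra.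
have A0 : 0 < A by lra.
have AB0 : 0 < A * B ^+ 2 by rewrite mulr_gt0 ?exprn_gt0.
have B40 : 0 < B ^+ 4 by rewrite exprn_gt0.
have AB30 : 0 < 2 * A * B ^+ 3 by rewrite !mulr_gt0 ?exprn_gt0 //; lra.
have C0 : 0 < C by rewrite CE; lra.
(* Under [c k], Chebyshev at exponent 2k, after trading [MY] for [MX], bounds [PY z] by B^-4k. *)
pose c k := (A * B ^+ 2) ^+ (2 * k) * MX k <= z ^+ (2 * k).
have small k : (0 < k)%N -> c k -> B ^+ (4 * k) * PY z <= 1.
  move=> k0 ck.
  have zk0 : 0 < z ^+ (2 * k) by rewrite exprn_gt0.
  have Ak0 : 0 < A ^+ (2 * k) by rewrite exprn_gt0.
  have h1 := le_trans (PYmk k z (ltW z0)) (YX k k0).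
  have e4 : (2 * (2 * k) = 4 * k)%N by rewrite mulnA.
  move: ck; rewrite /c [(A * _) ^+ _]exprMn -(exprM B) e4 => ck.
  rewrite -(ler_pM2l zk0) mulr1; apply: le_trans ck.
  rewrite mulrCA [A ^+ _ * _]mulrC -mulrA.
  by rewrite ler_wpM2l // ltW // exprn_gt0.
(* Paley-Zygmund with [s] = 1 / (2 b MX k) gives the lower bound 1 / (4 B^4k). The level [z / C] is
   admissible because C >= 2 A B^3, whose 2 pays for the factor 2 in front of the power of the
   level. *)
have large k : (0 < k)%N -> z ^+ (2 * k) <= (A * B ^+ 3) ^+ (2 * k) * MX k ->
    1 <= 4 * B ^+ (4 * k) * PX (z / C).
  move=> k0 zk; set b := B ^+ (4 * k).
  have b0 : 0 < b by rewrite exprn_gt0.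
  have M0 : 0 < MX k.
    rewrite lt_def MX0 andbT; apply: contraTneq zk => ->.
    by rewrite mulr0 -ltNge exprn_gt0.
  have zC : 2 * (z / C) ^+ (2 * k) <= MX k.
    rewrite expr_div_n mulrA ler_pdivrMr ?exprn_gt0 //.
    apply: (@le_trans _ _ (2 * ((A * B ^+ 3) ^+ (2 * k) * MX k))).
      by rewrite ler_pM2l.
    rewrite mulrA [leRHS]mulrC ler_wpM2r // ?MX0 //.
    apply: (@le_trans _ _ ((2 * (A * B ^+ 3)) ^+ (2 * k))).
      rewrite [leRHS]exprMn ler_wpM2r // ?exprn_ge0 ?mulr_ge0 ?exprn_ge0 ?(ltW A0)
        ?(ltW B0) //.
      by apply: (@ler_natr_expr 2 2) => //; rewrite leq_pmulr.
    apply: lerXn2r; [|by rewrite nnegrE ltW|by rewrite mulrA CE; lra].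
    by rewrite nnegrE mulrA ltW.
  have := PXpz k (z / C) (2 * b * MX k)^-1 (divr_ge0 (ltW z0) (ltW C0)) _ zC.
  have s0 : 0 < (2 * b * MX k)^-1 by rewrite invr_gt0 !mulr_gt0 //; lra.
  move=> /(_ (ltW s0)) h.
  rewrite -ler_pdivrMl ?mulr_gt0 // mulr1; apply: le_trans h.
  have h2 := ler_wpM2l (sqr_ge0 (2 * b * MX k)^-1) (XX k k0).
  apply: (@le_trans _ _ ((2 * b * MX k)^-1 * MX k -
    (2 * b * MX k)^-1 ^+ 2 * (b * MX k ^+ 2))); last by rewrite lerB.
  rewrite le_eqVlt; apply/orP; left; apply/eqP; field.
  by rewrite !gt_eqF.
have PXC0 : 0 <= PX (z / C) by case/andP: (PX01 (z / C)).
(* If [c] holds at all powers of 2, [small] forces [PY z] to vanish. Otherwise the least failing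
   power 2^(j+1) is taken: success at 2^j feeds [small], failure at 2^(j+1) feeds [large] at 2^j. *)
have [ex|/forallNP/= call] := pselect (exists j, ~~ c (2 ^ j)%N); last first.
  apply: (@le_trans _ _ (0)); last by rewrite mulr_ge0 // ltW.
  rewrite leNgt; apply/negP => PY0.
  have n0 : 0 <= (PY z)^-1 by rewrite invr_ge0 ltW.
  move: (archi_boundP n0); move: (Num.bound _) => n nlt.
  have cn : c (2 ^ n)%N by have /negP := call n; rewrite negbK.
  have := small _ (expn_gt0 2 n) cn.
  have hn : n%:R <= B ^+ (4 * 2 ^ n).
    apply: ler_natr_expr => //.
    by rewrite (leq_trans (ltnW (ltn_expl n (ltnSn 1)))) // leq_pmull.
  rewrite leNgt => /negP; apply.
  rewrite -ltr_pdivrMr // div1r; exact: lt_le_trans hn.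
(* If [c] fails already at 1, the trivial bound [PY z <= 1] stands in for Chebyshev; this case
   accounts for the summand 4 B^4 of [C]. *)
case: (ex_minnP ex) => -[|j] nc jmin.
  have h : 1 <= 4 * B ^+ (4 * 1) * PX (z / C).
    apply: large => //; rewrite expn0 /c -ltNge in nc.
    apply: (le_trans (ltW nc)); rewrite ler_wpM2r //.
    rewrite lerXn2r ?nnegrE ?mulr_ge0 ?exprn_ge0 ?(ltW A0) ?(ltW B0) //.
    by rewrite ler_pM2l // ler_eXn2l //; lra.
  case/andP: (PY01 z) => _ h1; apply: (le_trans h1); apply: (le_trans h).
  by rewrite ler_wpM2r // CE muln1; lra.
have cj : c (2 ^ j)%N.
  by apply/negPn/negP => /jmin; rewrite ltnn.
set k := (2 ^ j)%N in cj.
have k0 : (0 < k)%N by rewrite expn_gt0.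
have e2 : (2 ^ j.+1 = k + k)%N by rewrite expnS mul2n addnn.
have e4 : (2 * k * 2 = 4 * k)%N by rewrite mulnAC.
have e4' : (2 * (k + k) = 4 * k)%N by rewrite addnn -mul2n mulnA.
have h1 := small k k0 cj.
have h : 1 <= 4 * B ^+ (4 * k) * PX (z / C).
  (* Failure of [c] at 2k, with [XX] bounding [MX (k + k)], is the square of what [large] asks for
     at [k]; the doubling constant turns B^2 into B^3. *)
  apply: large => //; move: nc; rewrite /c e2 -ltNge => nc.
  have z2k : 0 <= z ^+ (2 * k) by rewrite exprn_ge0 // ltW.
  have M2k : 0 <= (A * B ^+ 3) ^+ (2 * k) * MX k.
    by rewrite mulr_ge0 // exprn_ge0 // mulr_ge0 ?exprn_ge0 ?(ltW A0) ?(ltW B0).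
  rewrite -ler_sqr ?nnegrE // exprMn -!exprM e4.
  rewrite e4' in nc; apply: (le_trans (ltW nc)).
  apply: (le_trans (ler_wpM2l _ (XX k k0))).
    by rewrite exprn_ge0 // ltW.
  by rewrite mulrA ler_wpM2r ?sqr_ge0 // -exprMn -mulrA -exprSr.
rewrite -(@ler_pM2l _ (B ^+ (4 * k))) ?exprn_gt0 //.
apply: (le_trans h1); apply: (le_trans h).
rewrite [4 * _]mulrC -mulrA ler_wpM2l ?exprn_ge0 ?(ltW B0) // ler_wpM2r //.
have := exprn_ege1 4 (_ : 1 <= B); rewrite CE; lra.
Qed.
End TailMoment.

(** In the induction step the defect is t (1 - t) (x - y) (x^n - y^n), nonnegative because powers
    are monotone. *)
Lemma convex_exprn (R : realFieldType) n (t x y : R) :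
  0 <= t <= 1 -> 0 <= x -> 0 <= y ->
  ((1 - t) * x + t * y) ^+ n <= (1 - t) * x ^+ n + t * y ^+ n.
Proof.
move=> /andP[t0 t1] x0 y0; elim: n => [|n IH]; first by rewrite !expr0; lra.
have t1' : 0 <= 1 - t by rewrite subr_ge0.
rewrite exprS; apply: (le_trans (ler_wpM2l _ IH)).
  by rewrite addr_ge0 // mulr_ge0.
have h : 0 <= (x - y) * (x ^+ n - y ^+ n).
  have [xy|/ltW yx] := leP x y.
    by rewrite mulr_le0 // subr_le0 // lerXn2r.
  by rewrite mulr_ge0 // subr_ge0 // lerXn2r.
have := mulr_ge0 (mulr_ge0 t0 t1') h; rewrite !exprS.
move: (x ^+ n) (y ^+ n) => a b; lra.
Qed.

Lemma ler_exprDn (R : realFieldType) n (x y : R) : 0 <= x -> 0 <= y ->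
  (x + y) ^+ n <= 2 ^+ n * ((x ^+ n + y ^+ n) / 2).
Proof.
move=> x0 y0; have -> : x + y = 2 * ((1 - 2^-1) * x + 2^-1 * y) by field.
rewrite exprMn ler_wpM2l ?exprn_ge0 //.
apply: (le_trans (convex_exprn n _ x0 y0)); last first.
  by rewrite le_eqVlt; apply/orP; left; apply/eqP; field.
by apply/andP; split; lra.
Qed.

(** * Random signs against fixed unimodular weights *)

Section Contraction.
Variable R : realFieldType.
Variables (a u v : nat -> R) (m : nat).
Hypothesis uv1 : forall i, u i ^+ 2 + v i ^+ 2 = 1.

Let usqr_le1 i : u i ^+ 2 <= 1.
Proof. by rewrite -(uv1 i) lerDl sqr_ge0. Qed.

Let vsqr_le1 i : v i ^+ 2 <= 1.
Proof. by rewrite -(uv1 i) lerDr sqr_ge0. Qed.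

(** When [u] and [v] are the real and imaginary parts of the characters at a point, this is the
    squared modulus there of the character sum with signs [s]. *)
Definition rsum2 s : R :=
  rsum (fun i => a i * u i) m s ^+ 2 + rsum (fun i => a i * v i) m s ^+ 2.

Lemma sgn_mean_unimodular_le k :
  sgn_mean m (fun s => rsum2 s ^+ k) <= 2 ^+ k * rmom a m k.
Proof.
have contr (w : nat -> R) : (forall i, w i ^+ 2 <= 1) ->
    rmom (fun i => a i * w i) m k <= rmom a m k.
  by move=> w1; apply: le_rmom => i _; rewrite exprMn ler_piMr ?sqr_ge0.
apply: (@le_trans _ _ (sgn_mean m (fun s => 2 ^+ k / 2 *
    (rsum (fun i => a i * u i) m s ^+ (2 * k) +
     rsum (fun i => a i * v i) m s ^+ (2 * k))))).
  apply: le_sgn_mean => s _ _; rewrite !exprM.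
  by apply: (le_trans (ler_exprDn _ (sqr_ge0 _) (sqr_ge0 _))); rewrite [(_ + _) / 2]mulrC mulrA.
rewrite sgn_meanZ sgn_meanD -mulrA ler_wpM2l ?exprn_ge0 //.
by rewrite ler_pdivrMl //; have := contr u usqr_le1; have := contr v vsqr_le1;
  rewrite /rmom; lra.
Qed.

(** The reverse bound is again a contraction: [a] splits as a u^2 + a v^2, and a u^2 is a
    contraction of a u, likewise for [v]. *)
Lemma le_sgn_mean_unimodular k :
  rmom a m k <= 4 ^+ k * sgn_mean m (fun s => rsum2 s ^+ k).
Proof.
have contr (w : nat -> R) : (forall i, w i ^+ 2 <= 1) ->
    rmom (fun i => a i * w i ^+ 2) m k <= rmom (fun i => a i * w i) m k.
  move=> w1; apply: le_rmom => i _; rewrite !exprMn ler_wpM2l ?sqr_ge0 //.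
  by rewrite ler_piMr ?sqr_ge0.
pose U w s := rsum (fun i => a i * w i ^+ 2) m s ^+ (2 * k).
pose V w s := rsum (fun i => a i * w i) m s ^+ (2 * k).
apply: (@le_trans _ _ (sgn_mean m (fun s => 4 ^+ k / 2 * (U u s + U v s)))).
  apply: le_sgn_mean => s _ _.
  have -> : rsum a m s = rsum (fun i => a i * u i ^+ 2) m s +
      rsum (fun i => a i * v i ^+ 2) m s.
    by rewrite /rsum -big_split; apply: eq_bigr => i _ /=; rewrite -mulrDl -mulrDr uv1 mulr1.
  have sq (x : R) : x ^+ (2 * k) = `|x| ^+ (2 * k) by rewrite !exprM real_normK ?num_real.
  rewrite sq; apply: (le_trans (lerXn2r _ _ _ (ler_normD _ _))); rewrite ?nnegrE ?addr_ge0 //.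
  apply: (le_trans (ler_exprDn _ (normr_ge0 _) (normr_ge0 _))).
  by rewrite -!sq exprM -natrX [(_ + _) / 2]mulrC mulrA.
apply: (@le_trans _ _ (sgn_mean m (fun s => 4 ^+ k / 2 * (V u s + V v s)))).
  rewrite !sgn_meanZ !sgn_meanD ler_wpM2l ?divr_ge0 ?exprn_ge0 //.
  by rewrite lerD ?contr.
rewrite -sgn_meanZ; apply: le_sgn_mean => s _ _.
rewrite -mulrA ler_wpM2l ?exprn_ge0 // ler_pdivrMl // mulrDl mul1r /rsum2.
by rewrite /V !exprM; apply: lerD; apply: lerXn2r;
  rewrite ?nnegrE ?addr_ge0 ?sqr_ge0 // ?lerDl ?lerDr sqr_ge0.
Qed.

End Contraction.

Lemma tail_moment_sgn (R : realType) (a : nat -> R) m :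
  tail_moment (fun z => sgn_mean m (fun s => (z < `|rsum a m s|)%R%:R))
    (rmom a m).
Proof.
have -> : rmom a m = fun k => sgn_mean m (fun s => `|rsum a m s| ^+ (2 * k)).
  apply/funext => k; apply: eq_sgn_mean => s _ _.
  by rewrite !exprM real_normK ?num_real.
apply: (@tail_moment_expectation _ _ (fun=> True)) => //.
- by move=> F G _ _; rewrite sgn_meanD.
- by move=> c F _; rewrite sgn_meanZ.
- by move=> c; rewrite sgn_mean_cst.
- by move=> F G _ _ FG; apply: le_sgn_mean.
Qed.

(** * The Rademacher functions on [0, 1] *)

Section RademacherDistribution.
Variable R : realType.
Local Notation lambda := (@lebesgue_measure R).

Lemma null_point (c : R) (P : R -> Prop) :
  measurable [set t | t = c /\ P t] /\ lambda [set t | t = c /\ P t] = 0%E.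
Proof.
have [Pc|nPc] := pselect (P c).
  have -> : [set t | t = c /\ P t] = [set c].
    by apply/seteqP; split => t /= [] // ->.
  by split; [exact: measurable_set1|exact: lebesgue_measure_set1].
have -> : [set t | t = c /\ P t] = set0.
  by apply/seteqP; split => t //= [-> /nPc].
by split; rewrite ?measure0.
Qed.

Lemma sin_natD (j : nat) (y : R) : sin (pi * (y + (2 * j)%:R)) = sin (pi * y).
Proof.
have -> : pi * (y + (2 * j)%:R) = pi * y + pi *+ 2 *+ j.
  by rewrite mulrDr -mulrnA mulr_natr.
exact: periodicn (@sinD2pi R) _ _.
Qed.

(** Open intervals, since Rademacher functions can vanish at dyadic points; those points are split
    off as null sets. *)
Let dyadic l j : set R := [set t | j%:R < 2 ^+ l * t < (j.+1)%:R].

Lemma rademacher_left l j t : dyadic l (2 * j) t -> rademacher l t = 1.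
Proof.
move=> /= /andP[h1 h2]; rewrite /rademacher gtr0_sg //.
have -> : 2 ^+ l * pi * t = pi * ((2 ^+ l * t - (2 * j)%:R) + (2 * j)%:R).
  by rewrite subrK; ring.
rewrite sin_natD sin_gt0_pi //; move: h1 h2; set y := 2 ^+ l * t.
rewrite -natr1 => h1 h2.
by rewrite mulr_gt0 ?pi_gt0 ?subr_gt0 //= gtr_pMr ?pi_gt0 //; lra.
Qed.

Lemma rademacher_right l j t : dyadic l (2 * j).+1 t -> rademacher l t = -1.
Proof.
move=> /= /andP[h1 h2]; rewrite /rademacher ltr0_sg //.
have -> : 2 ^+ l * pi * t = pi * ((2 ^+ l * t - (2 * j).+1%:R) + 1 + (2 * j)%:R).
  by rewrite -natr1; ring.
rewrite sin_natD mulrDr mulr1 sinDpi oppr_lt0 sin_gt0_pi //; move: h1 h2.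
rewrite -[(2 * j).+2%:R]natr1; set y := 2 ^+ l * t => h1 h2.
by rewrite mulr_gt0 ?pi_gt0 ?subr_gt0 //= gtr_pMr ?pi_gt0 //; lra.
Qed.

Lemma dyadic_measure l j :
  measurable (dyadic l j) /\ lambda (dyadic l j) = (2 ^- l)%:E.
Proof.
have l0 : 0 < 2 ^+ l :> R by rewrite exprn_gt0.
have -> : dyadic l j = [set` `](j%:R / 2 ^+ l), (j.+1%:R / 2 ^+ l)[%R].
  apply/seteqP; split => t; rewrite /= in_itv /= ltr_pdivrMr // ltr_pdivlMr //;
  by rewrite mulrC.
split; first exact: measurable_itv.
rewrite lebesgue_measure_itv /= lte_fin ltr_pM2r ?invr_gt0 // ltr_nat ltnSn.
by rewrite -EFinB -mulrBl -natr1 addrAC subrr add0r mul1r.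
Qed.

Lemma dyadic_split l j : dyadic l j =
  dyadic l.+1 (2 * j) `|` dyadic l.+1 (2 * j).+1 `|`
    [set (2 * j).+1%:R / 2 ^+ l.+1].
Proof.
have e (t : R) : 2 ^+ l.+1 * t = 2 * (2 ^+ l * t) by rewrite exprS mulrA.
have l0 : 2 ^+ l.+1 != 0 :> R by rewrite expf_neq0.
have e1 : (2 * j).+1%:R = 2 * j%:R + 1 :> R by rewrite -natr1 natrM.
have e2 : (2 * j).+2%:R = 2 * j%:R + 2 :> R by rewrite -!natr1 natrM; ring.
apply/seteqP; split => t; rewrite /dyadic /= e -?[j.+1%:R]natr1 e1 e2 natrM.
  move=> /andP[h1 h2].
  have [h|h|h] := ltgtP (2 * (2 ^+ l * t)) (2 * j%:R + 1).
  - by left; left; apply/andP; split => //; lra.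
  - by left; right; apply/andP; split => //; lra.
  - by right; rewrite -h -e mulrAC divff ?mul1r.
case=> [[|]|->]; try by move=> /andP[h1 h2]; apply/andP; split; lra.
have -> : 2 ^+ l * ((2 * j%:R + 1) / 2 ^+ l.+1) = j%:R + 1 / 2 :> R.
  by rewrite exprS; field; rewrite expf_neq0.
by apply/andP; split; lra.
Qed.

(** On a dyadic interval of level [l] the Rademacher functions of index above [l] are independent
    fair signs: the next one is 1 on the left half and -1 on the right half, so halving reproduces
    the recursion of [sgn_mean], up to the midpoint. *)
Lemma dyadic_sgn_mean m l j (Q : seq R -> bool) :
  let A := [set t | dyadic l j t /\ Q [seq rademacher i t | i <- iota l.+1 m]] in
  measurable A /\
  lambda A = (2 ^- l * sgn_mean m (fun s => (Q s)%:R))%:E.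
Proof.
elim: m l j Q => [|m IH] l j Q A.
  have [mD lD] := dyadic_measure l j.
  rewrite /A /=; case: (Q [::]) => /=; last first.
    rewrite (_ : [set t | _] = set0); last by apply/seteqP; split => t // [].
    by rewrite measure0 mulr0.
  rewrite (_ : [set t | _] = dyadic l j) ?mulr1 //.
  by apply/seteqP; split => t // [].
pose mid : R := (2 * j).+1%:R / 2 ^+ l.+1.
pose A1 := [set t | dyadic l.+1 (2 * j) t /\
  Q (1 :: [seq rademacher i t | i <- iota l.+2 m])].
pose A2 := [set t | dyadic l.+1 (2 * j).+1 t /\
  Q (-1 :: [seq rademacher i t | i <- iota l.+2 m])].
pose A3 := [set t | t = mid /\ Q [seq rademacher i t | i <- iota l.+1 m.+1]].
have [m1 l1] : measurable A1 /\ _ := IH l.+1 (2 * j)%N (fun s => Q (1 :: s)).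
have [m2 l2] : measurable A2 /\ _ := IH l.+1 (2 * j).+1 (fun s => Q (-1 :: s)).
have [m3 l3] : measurable A3 /\ lambda A3 = 0%E := null_point mid _.
have -> : A = A1 `|` A2 `|` A3.
  rewrite /A dyadic_split; apply/seteqP; split => t.
    move=> [[[tl|tr]|tm] Qt].
    - by left; left; split; rewrite // -(rademacher_left tl).
    - by left; right; split; rewrite // -(rademacher_right tr).
    - by right.
  move=> [[[tl Qt]|[tr Qt]]|[tm Qt]].
  - by split; [left; left|rewrite /= (rademacher_left tl)].
  - by split; [left; right|rewrite /= (rademacher_right tr)].
  - by split; [right|].
have m12 : measurable (A1 `|` A2) by exact: measurableU.
split; first exact: measurableU.
rewrite measureU0 // measureU //; last first.
  apply/seteqP; split => t // [[/= /andP[_ h1] _] [/= /andP[h2 _] _]].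
  by have := lt_trans h1 h2; rewrite ltxx.
transitivity (lambda A1 + lambda A2)%E => //.
rewrite [lambda A1]l1 [lambda A2]l2 -EFinD -mulrDr /= exprS; congr EFin.
by field; rewrite expf_neq0.
Qed.

(* The 0-indexed function [rademacher 0] is 1 on ]0, 1[, so the sum there is a
   randomly signed sum with the first sign fixed; its modulus has the same law
   as with a free first sign. *)
Lemma rademacher_tail (a : nat -> R) m z : 0 < z ->
  lambda [set t : R | (0 <= t <= 1)%R /\
    (z < `|\sum_(n < m) a n * rademacher n t|)%R] =
  (sgn_mean m (fun s => (z < `|rsum a m s|)%R%:R))%:E.
Proof.
move=> z0; case: m => [|m].
  rewrite (_ : [set t | _] = set0) ?measure0 /= /rsum.
    by rewrite big_ord0 normr0 ltNge (ltW z0).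
  by apply/seteqP; split => t //= []; rewrite big_ord0 normr0 ltNge (ltW z0).
pose Q s := (z < `|rsum a m.+1 (1 :: s)|)%R.
pose P t := (z < `|\sum_(n < m.+1) a n * rademacher n t|)%R.
pose A := [set t | dyadic 0 0 t /\ Q [seq rademacher i t | i <- iota 1 m]].
have [mA lA] : measurable A /\ _ := dyadic_sgn_mean m 0 0 Q.
have [m0 l0] := null_point 0 P; have [m1 l1] := null_point 1 P.
rewrite (_ : [set t | _] = A `|` [set t | t = 0 /\ P t] `|` [set t | t = 1 /\ P t]).
  rewrite !measureU0 //; last exact: measurableU.
  transitivity (lambda A) => //; rewrite lA expr0 invr1 mul1r /=; congr EFin.
  rewrite -[X in _ = (_ + X) / 2]sgn_mean_opp /=.
  rewrite (_ : sgn_mean m (fun s => (z < `|rsum a m.+1 (-1 :: map -%R s)|)%R%:R) =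
    sgn_mean m (fun s => (Q s)%:R)).
    by rewrite -[X in (X + _) / 2]/(sgn_mean m (fun s => (Q s)%:R)); field.
  apply: eq_sgn_mean => s sm _; congr (_%:R); congr (_ < _).
  by rewrite -[-1 :: _]/(map -%R (1 :: s)) rsum_opp ?normrN //= sm.
have AP t : dyadic 0 0 t -> Q [seq rademacher i t | i <- iota 1 m] = P t.
  move=> dt; congr (_ < `| _ |); rewrite rsum_cons big_ord_recl.
  congr (_ * _ + _); first by rewrite (@rademacher_left 0 0).
  apply: eq_bigr => i _ /=; congr (_ * _).
  by rewrite (nth_map 0%N) ?size_iota // nth_iota.
apply/seteqP; split => t.
  move=> /= [/andP[t0 t1] Pt].
  have [t0'|t0'|t0'] := ltgtP 0 t; last by left; right; split.
    have [t1'|t1'|t1'] := ltgtP t 1; last by right; split.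
      have dt : dyadic 0 0 t by rewrite /dyadic /= expr0 mul1r t0' t1'.
      by left; left; split=> //; rewrite AP.
    by move: t1; rewrite leNgt t1'.
  by move: t0; rewrite leNgt t0'.
move=> [[[dt Qt]|[-> Pt]]|[-> Pt]] /=; [|by rewrite lexx ler01|by rewrite lexx ler01].
split; last by rewrite -/(P t) -AP.
by move: dt; rewrite /dyadic /= expr0 mul1r => /andP[/ltW -> /ltW ->].
Qed.

End RademacherDistribution.

(** * Means over a compact abelian group *)

Section HaarMean.
Variables (R : realType) (G : topologicalZmodType).
Variable mu : {measure set borelG G -> \bar R}.
Hypothesis cptG : compact [set: G].
Hypothesis haar : is_normalized_haar mu.
Implicit Types (h : G -> R) (f g : G -> R[i]).

Definition mean h : R := Rintegral mu setT (h : borelG G -> R).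

Definition bounded_measurable h :=
  measurable_fun setT (h : borelG G -> R) /\ exists M, forall x, `|h x| <= M.

Let muT : mu setT = 1%E. Proof. by case: haar. Qed.

Lemma measurable_continuous h : continuous h ->
  measurable_fun setT (h : borelG G -> R).
Proof.
move=> /continuousP ch; apply: (measurability _ (RGenOpens.measurableE R)).
move=> _ [_ [a [b ->] <-]]; rewrite setTI.
by apply: sub_sigma_algebra; exact: ch (interval_open _ _).
Qed.

Lemma bounded_measurable_continuous h : continuous h -> bounded_measurable h.
Proof.
move=> ch; split; first exact: measurable_continuous.
have /compact_bounded[M [_ hM]] : compact (h @` setT).
  by apply: continuous_compact => //; exact: continuous_subspaceT.
exists (M + 1) => x; apply: hM; first by rewrite ltrDl.
by exists x.
Qed.

Lemma bounded_measurable_integrable h : bounded_measurable h ->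
  mu.-integrable setT (EFin \o (h : borelG G -> R)).
Proof.
move=> [mh [M hM]]; apply: measurable_bounded_integrable => //.
  by rewrite muT ltry.
exists M; split; first exact: num_real.
by move=> N MN x _; apply: le_trans (hM x) (ltW MN).
Qed.

Lemma bounded_measurableD h1 h2 : bounded_measurable h1 ->
  bounded_measurable h2 -> bounded_measurable (fun x => h1 x + h2 x).
Proof.
move=> [m1 [M1 b1]] [m2 [M2 b2]]; split; first exact: measurable_funD.
by exists (M1 + M2) => x; rewrite (le_trans (ler_normD _ _)) // lerD.
Qed.

Lemma bounded_measurable_cst (c : R) : bounded_measurable (fun=> c).
Proof. by split; [exact: measurable_cst|exists `|c|]. Qed.

Lemma bounded_measurableZ (c : R) h : bounded_measurable h ->
  bounded_measurable (fun x => c * h x).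
Proof.
move=> [mh [M b]]; split.
  by apply: measurable_funM => //; exact: measurable_cst.
by exists (`|c| * M) => x; rewrite normrM ler_wpM2l.
Qed.

Lemma meanD h1 h2 : bounded_measurable h1 -> bounded_measurable h2 ->
  mean (fun x => h1 x + h2 x) = mean h1 + mean h2.
Proof.
by move=> b1 b2; apply: RintegralD => //; exact: bounded_measurable_integrable.
Qed.

Lemma meanZ (c : R) h : bounded_measurable h ->
  mean (fun x => c * h x) = c * mean h.
Proof.
by move=> b; apply: RintegralZl => //; exact: bounded_measurable_integrable.
Qed.

Lemma mean_cst (c : R) : mean (fun=> c) = c.
Proof. by rewrite /mean Rintegral_cst // muT mulr1. Qed.

Lemma le_mean h1 h2 : bounded_measurable h1 -> bounded_measurable h2 ->
  (forall x, h1 x <= h2 x) -> mean h1 <= mean h2.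
Proof.
by move=> b1 b2 h12; apply: le_Rintegral => //; exact: bounded_measurable_integrable.
Qed.

Lemma mean_sum n (h : nat -> G -> R) :
  (forall i, bounded_measurable (h i)) ->
  mean (fun x => \sum_(i < n) h i x) = \sum_(i < n) mean (h i).
Proof.
move=> b; elim: n => [|n IH].
  by rewrite big_ord0 -[RHS]mean_cst; congr mean; apply/funext => x; rewrite big_ord0.
rewrite big_ord_recr /= -IH -meanD //.
  by congr mean; apply/funext => x; rewrite big_ord_recr.
elim: n {IH} => [|n IH].
  rewrite (_ : (fun x => _) = fun=> 0); first exact: bounded_measurable_cst.
  by apply/funext => x; rewrite big_ord0.
rewrite (_ : (fun x => _) = fun x => \sum_(i < n) h i x + h n x).
  exact: bounded_measurableD.
by apply/funext => x; rewrite big_ord_recr.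
Qed.

Lemma translation_continuous (x : G) : continuous (fun y : G => x + y).
Proof.
move=> y; apply: (@continuous_comp _ _ _ (fun z => (x, z)) (fun z : G * G => z.1 + z.2)).
  by apply: cvg_pair; [exact: cvg_cst|exact: cvg_id].
exact: add_continuous.
Qed.

Lemma mean_translation h (x : G) : continuous h ->
  mean (fun y => h (x + y)) = mean h.
Proof.
move=> ch; pose T : borelG G -> borelG G := fun y : G => x + y.
have mT : measurable_fun setT T.
  apply: (@measurability _ _ (borelG G) (borelG G) _ _ (@open G)) => //.
  move=> _ [A oA <-]; rewrite setTI; apply: sub_sigma_algebra.
  by move/continuousP : (@translation_continuous x); apply.
have mcomp : measurable_fun setT ((h : borelG G -> R) \o T).
  by apply: measurableT_comp => //; exact: measurable_continuous.
have [_ [M hM]] := bounded_measurable_continuous ch.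
have iT : mu.-integrable setT (EFin \o ((h : borelG G -> R) \o T)).
  by apply: bounded_measurable_integrable; split=> //; exists M => y; apply: hM.
rewrite /mean /Rintegral; congr fine.
have mh : measurable_fun setT (EFin \o (h : borelG G -> R)).
  by apply/measurable_EFinP; exact: measurable_continuous.
rewrite -[LHS](@integral_pushforward _ _ _ _ _ T mT mu setT _ mh iT) //.
apply: eq_measure_integral => A mA _; rewrite /= /pushforward.
(* The preimage of [A] under translation by [x] is its image under translation by [- x], and
   invariance is stated for images. *)
case: haar => _ /(_ (- x) A mA) <- _; congr (mu _).
apply/seteqP; split => [y Ay|_ [y Ay <-]]; last by rewrite /= /T addNKr.
by exists (T y) => //; rewrite /T addKr.
Qed.

Lemma tail_moment_mean h : continuous h -> (forall x, 0 <= h x) ->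
  tail_moment (fun z => fine (mu [set x | z < h x])) 
    (fun k => mean (fun x => h x ^+ (2 * k))).
Proof.
move=> ch h0; have mh := measurable_continuous ch.
have mA z : measurable ([set x | z < h x] : set (borelG G)).
  have := mh measurableT _ (measurable_itv `]z, +oo[%R); rewrite setTI.
  congr measurable; apply/seteqP; split => x; by rewrite /= in_itv /= andbT.
have -> : (fun z => fine (mu [set x | z < h x])) =
    fun z => mean (fun x => (z < h x)%R%:R).
  apply/funext => z; rewrite -[X in mu X]setIT -integral_indic //.
  congr fine; apply: eq_integral => x _; congr EFin; rewrite indicE.
  by congr (_%:R); congr nat_of_bool; apply/idP/idP; rewrite inE.
apply: (@tail_moment_expectation _ _ bounded_measurable) => //.
- exact: bounded_measurableD.
- exact: meanD.
- exact: bounded_measurableZ.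
- exact: meanZ.
- exact: bounded_measurable_cst.
- exact: mean_cst.
- exact: le_mean.
- move=> n; apply: bounded_measurable_continuous => x.
  apply: (@continuous_comp _ _ _ h (@GRing.exp R ^~ n)); first exact: ch.
  exact: exprn_continuous.
- move=> z; split; last by exists 1 => x; rewrite normr_nat; case: ltP.
  rewrite (_ : (fun x => _) = \1_[set x | z < h x]); first exact: measurable_indic.
  apply/funext => x; rewrite indicE.
  by congr (_%:R); congr nat_of_bool; apply/idP/idP; rewrite inE.
Qed.

End HaarMean.

(** * Complex arithmetic through real and imaginary parts *)

Section ComplexParts.
Variable R : rcfType.
Implicit Types x y z : R[i].
Local Notation normc := (@Normc.normc R).

Lemma ReD x y : complex.Re (x + y) = complex.Re x + complex.Re y.
Proof. by case: x y => [? ?] [? ?]. Qed.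

Lemma ImD x y : complex.Im (x + y) = complex.Im x + complex.Im y.
Proof. by case: x y => [? ?] [? ?]. Qed.

Lemma ReM x y : complex.Re (x * y) =
  complex.Re x * complex.Re y - complex.Im x * complex.Im y.
Proof. by case: x y => [? ?] [? ?]. Qed.

Lemma ImM x y : complex.Im (x * y) =
  complex.Re x * complex.Im y + complex.Im x * complex.Re y.
Proof. by case: x y => [? ?] [? ?]. Qed.

Lemma Re_sum n (f : nat -> R[i]) :
  complex.Re (\sum_(i < n) f i) = \sum_(i < n) complex.Re (f i).
Proof. by elim: n => [|n IH]; rewrite ?big_ord0 // !big_ord_recr /= ReD IH. Qed.

Lemma Im_sum n (f : nat -> R[i]) :
  complex.Im (\sum_(i < n) f i) = \sum_(i < n) complex.Im (f i).
Proof. by elim: n => [|n IH]; rewrite ?big_ord0 // !big_ord_recr /= ImD IH. Qed.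

Lemma normc_ge0 z : 0 <= normc z.
Proof. by case: z => a b; rewrite sqrtr_ge0. Qed.

Lemma normc_sqr z : normc z ^+ 2 = complex.Re z ^+ 2 + complex.Im z ^+ 2.
Proof. by case: z => a b /=; rewrite sqr_sqrtr // addr_ge0 ?sqr_ge0. Qed.

Lemma normc_real (a : R) : normc (a%:C)%C = `|a|.
Proof. by rewrite /= expr0n addr0 sqrtr_sqr. Qed.

Lemma normc_conj z : normc (z^*)%C = normc z.
Proof. by case: z => a b /=; rewrite sqrrN. Qed.

Lemma Re_le_normc z : complex.Re z <= normc z.
Proof.
apply: (le_trans (ler_norm _)).
by rewrite -ler_sqr ?nnegrE ?normc_ge0 // real_normK ?num_real // normc_sqr lerDl sqr_ge0.
Qed.

Lemma mul_conjc z : (z^*)%C * z = ((normc z ^+ 2)%:C)%C.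
Proof.
rewrite normc_sqr; case: z => a b; apply/eqP.
by rewrite eq_complex /=; apply/andP; split; apply/eqP; ring.
Qed.

Lemma normc_sum n (f : nat -> R[i]) :
  normc (\sum_(i < n) f i) <= \sum_(i < n) normc (f i).
Proof.
elim: n => [|n IH]; first by rewrite !big_ord0 Normc.normc0.
by rewrite !big_ord_recr /= (le_trans (le_normcD _ _)) // lerD2r.
Qed.

(** This expansion serves the descent in [dominated_approx], where the summed cross term is
    nonpositive. *)
Lemma normc_sqr_convex (t : R) x y :
  normc (((1 - t)%:C)%C * x + (t%:C)%C * y) ^+ 2 =
  (1 - t) ^+ 2 * normc x ^+ 2 + 2 * t * (1 - t) * complex.Re ((x^*)%C * y) +
  t ^+ 2 * normc y ^+ 2.
Proof. by rewrite !normc_sqr; case: x y => [a b] [c d] /=; ring. Qed.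

(* The junk value [0^-1 = 0] makes [c = 0] work when [z = 0]. *)
Lemma phasec z : exists2 c, normc c <= 1 & c * z = ((normc z)%:C)%C.
Proof.
exists ((z^*)%C * ((normc z)^-1%:C)%C).
  rewrite Normc.normcM normc_conj normc_real ger0_norm ?invr_ge0 ?normc_ge0 //.
  by have [->|z0] := eqVneq (normc z) 0; rewrite ?mul0r // divff.
rewrite mulrAC mul_conjc -rmorphM /=; congr (_%:C)%C.
by have [->|z0] := eqVneq (normc z) 0; rewrite ?expr0n ?mul0r // expr2 mulfK.
Qed.

End ComplexParts.

(** * Continuity of complex-valued functions *)

Section ComplexContinuity.
Variables (R : realType) (G : topologicalZmodType).
Implicit Types f g : G -> R[i].

Lemma ccontinuous_cst (c : R[i]) : ccontinuous (fun _ : G => c).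
Proof. by split=> x; apply: cvg_cst. Qed.

Lemma ccontinuousD f g :
  ccontinuous f -> ccontinuous g -> ccontinuous (fun x => f x + g x).
Proof.
move=> [f1 f2] [g1 g2]; split.
  under eq_fun do rewrite ReD.
  by move=> x; apply: continuousD; [exact: f1|exact: g1].
under eq_fun do rewrite ImD.
by move=> x; apply: continuousD; [exact: f2|exact: g2].
Qed.

Lemma ccontinuousM f g :
  ccontinuous f -> ccontinuous g -> ccontinuous (fun x => f x * g x).
Proof.
move=> [f1 f2] [g1 g2]; split.
  under eq_fun do rewrite ReM.
  move=> x; apply: (@continuousB _ _ _
    (fun x => complex.Re (f x) * complex.Re (g x))
    (fun x => complex.Im (f x) * complex.Im (g x))); apply: continuousM;
    by [exact: f1|exact: f2|exact: g1|exact: g2].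
under eq_fun do rewrite ImM.
move=> x; apply: (@continuousD _ _ _
  (fun x => complex.Re (f x) * complex.Im (g x))
  (fun x => complex.Im (f x) * complex.Re (g x))); apply: continuousM;
  by [exact: f1|exact: f2|exact: g1|exact: g2].
Qed.

Lemma ccontinuous_conj f :
  ccontinuous f -> ccontinuous (fun x => (f x)^*)%C.
Proof.
have e1 (z : R[i]) : complex.Re (z^*)%C = complex.Re z by case: z.
have e2 (z : R[i]) : complex.Im (z^*)%C = - complex.Im z by case: z.
move=> [f1 f2]; split; first by under eq_fun do rewrite e1.
by under eq_fun do rewrite e2; move=> x; apply: continuousN; exact: f2.
Qed.

Lemma ccontinuous_sum n (f : nat -> G -> R[i]) :
  (forall i, ccontinuous (f i)) -> ccontinuous (fun x => \sum_(i < n) f i x).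
Proof.
move=> cf; elim: n => [|n IH].
  by under eq_fun do rewrite big_ord0; exact: ccontinuous_cst.
by under eq_fun do rewrite big_ord_recr /=; exact: ccontinuousD.
Qed.

Lemma normc_continuous f : ccontinuous f ->
  continuous (fun x => Normc.normc (f x)).
Proof.
move=> [f1 f2].
have -> : (fun x => Normc.normc (f x)) = Num.sqrt \o
    (fun x => complex.Re (f x) * complex.Re (f x) + complex.Im (f x) * complex.Im (f x)).
  by apply/funext => x /=; case: (f x) => a b /=; rewrite !expr2.
move=> x; apply: continuous_comp; last exact: sqrt_continuous.
apply: (@continuousD _ _ _ (fun x => complex.Re (f x) * complex.Re (f x))
  (fun x => complex.Im (f x) * complex.Im (f x))); apply: continuousM;
  by [exact: f1|exact: f2].
Qed.

Lemma character_mul_conj f g : is_character f -> is_character g ->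
  is_character (fun x => f x * (g x)^*)%C.
Proof.
move=> [cf fD f1] [cg gD g1]; split.
- by apply: ccontinuousM => //; exact: ccontinuous_conj.
- by move=> x y; rewrite fD gD rmorphM /= mulrACA.
- by move=> x; rewrite Normc.normcM normc_conj f1 g1 mulr1.
Qed.

End ComplexContinuity.

(** * Orthogonality of characters and the Sidon inequality for polynomials *)

Section Orthogonality.
Variables (R : realType) (G : topologicalZmodType).
Variable mu : {measure set borelG G -> \bar R}.
Hypothesis cptG : compact [set: G].
Hypothesis haar : is_normalized_haar mu.
Implicit Types f g : G -> R[i].

Let bm_Re f : ccontinuous f -> bounded_measurable (fun x => complex.Re (f x)).
Proof. by case=> ? _; exact: bounded_measurable_continuous. Qed.

Let bm_Im f : ccontinuous f -> bounded_measurable (fun x => complex.Im (f x)).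
Proof. by case=> _ ?; exact: bounded_measurable_continuous. Qed.

Lemma cintegralE f : cintegral mu f =
  Complex (mean mu (fun x => complex.Re (f x))) (mean mu (fun x => complex.Im (f x))).
Proof. by []. Qed.

Lemma cintegralZ (c : R[i]) f : ccontinuous f ->
  cintegral mu (fun x => c * f x) = c * cintegral mu f.
Proof.
move=> cf; have := bm_Re cf; have := bm_Im cf => bi br.
rewrite !cintegralE; apply/eqP; rewrite eq_complex ReM ImM /=.
have h a : (fun x => complex.Im (a * f x)) =
  (fun x => complex.Re a * complex.Im (f x) + complex.Im a * complex.Re (f x)).
  by apply/funext => x; rewrite ImM.
rewrite h meanD ?meanZ //; try exact: bounded_measurableZ.
have -> : (fun x => complex.Re (c * f x)) =
  (fun x => complex.Re c * complex.Re (f x) + (- complex.Im c) * complex.Im (f x)).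
  by apply/funext => x; rewrite ReM mulNr.
rewrite meanD ?meanZ //; try exact: bounded_measurableZ.
by rewrite mulNr !eqxx.
Qed.

Lemma cintegral_sum n (f : nat -> G -> R[i]) : (forall i, ccontinuous (f i)) ->
  cintegral mu (fun x => \sum_(i < n) f i x) = \sum_(i < n) cintegral mu (f i).
Proof.
move=> cf; apply/eqP; rewrite eq_complex.
rewrite (Re_sum n (fun i => cintegral mu (f i))).
rewrite (Im_sum n (fun i => cintegral mu (f i))) cintegralE /=.
rewrite -(mean_sum haar n (fun i => bm_Re (cf i))).
rewrite -(mean_sum haar n (fun i => bm_Im (cf i))).
by apply/andP; split; apply/eqP; congr mean; apply/funext => x;
  rewrite ?(Re_sum n (f^~ x)) ?(Im_sum n (f^~ x)).
Qed.

(** Translation by [y] preserves the integral and also multiplies it by [f y], which differs from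
    1. *)
Lemma cintegral_character f : is_character f -> (exists y, f y != 1) ->
  cintegral mu f = 0.
Proof.
move=> [cf fD f1] [y fy1].
have h : cintegral mu f = f y * cintegral mu f.
  rewrite -cintegralZ //; case: (cf) => c1 c2.
  rewrite !cintegralE -(mean_translation cptG haar y c1).
  rewrite -(mean_translation cptG haar y c2).
  by congr Complex; congr mean; apply/funext => x; rewrite fD.
apply/eqP; have /eqP := h; rewrite -subr_eq0 -{1}[cintegral _ _]mul1r -mulrBl mulf_eq0.
by rewrite subr_eq0 eq_sym (negbTE fy1).
Qed.

Lemma cintegral1 : cintegral mu (fun=> 1) = 1.
Proof. by rewrite cintegralE !(mean_cst haar). Qed.

Lemma fourier_character f g : is_character f -> is_character g ->
  fourier mu f g = (f == g)%:R.
Proof.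
move=> chf chg; rewrite /fourier; case: eqVneq => [<-|fg].
  rewrite (_ : (fun x => _) = fun=> 1) ?cintegral1 //.
  apply/funext => x; rewrite mulrC mul_conjc; case: chf => _ _ ->.
  by rewrite expr1n.
apply: cintegral_character; first exact: character_mul_conj.
apply: contrapT => /forallNP h; move/eqP: fg; apply; apply/funext => x.
have /negP := h x; rewrite negbK => /eqP fx.
have gx : (g x)^*%C * g x = 1.
  by rewrite mul_conjc; case: chg => _ _ ->; rewrite expr1n.
by rewrite -[LHS]mulr1 -gx mulrA fx mul1r.
Qed.

Variable gam : nat -> G -> R[i].
Hypothesis chgam : forall n, is_character (gam n).
Hypothesis injgam : injective gam.

Definition trigpoly (b : nat -> R[i]) m (x : G) := \sum_(n < m) b n * gam n x.

Lemma trigpoly_continuous b m : ccontinuous (trigpoly b m).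
Proof.
apply: (@ccontinuous_sum _ _ m (fun n x => b n * gam n x)) => n.
apply: ccontinuousM; first exact: ccontinuous_cst.
by case: (chgam n).
Qed.

Lemma fourier_trigpoly b m g : is_character g ->
  fourier mu (trigpoly b m) g = \sum_(n < m) b n * (gam n == g)%:R.
Proof.
move=> chg; rewrite /fourier.
rewrite (_ : (fun x => _) = fun x => \sum_(n < m) b n * (gam n x * (g x)^*%C)).
  have c n : ccontinuous (fun x => gam n x * (g x)^*)%C.
    by case: (character_mul_conj (chgam n) chg).
  rewrite (@cintegral_sum m (fun n x => b n * (gam n x * (g x)^*%C))) => [|n];
    last exact: ccontinuousM (ccontinuous_cst _ _) (c n).
  by apply: eq_bigr => n _; rewrite cintegralZ // -fourier_character.
by apply/funext => x; rewrite mulr_suml; apply: eq_bigr => n _; rewrite mulrA.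
Qed.

Variable K : R.
Hypothesis sidon : is_Sidon mu (range gam) K.

Lemma sidon_trigpoly (b : nat -> R[i]) m :
  \sum_(n < m) Normc.normc (b n) <= K * supnorm (trigpoly b m).
Proof.
rewrite -lee_fin; apply: le_trans (_ : _ <= \esum_(g in dual_group)
    (Normc.normc (fourier mu (trigpoly b m) g))%:E)%E _; last first.
  apply: sidon; split; first exact: trigpoly_continuous.
  move=> g chg ng; rewrite fourier_trigpoly // big1 // => n _.
  by case: eqP => [e|]; rewrite ?mulr0 //; case: ng; exists n.
apply: esum_ge; exists (gam @` `I_m).
  split; first by apply: finite_image; exact: finite_II.
  by move=> _ [n _ <-]; exact: chgam.
rewrite fsbig_image //; last by move=> i j _ _; exact: injgam.
rewrite -fsbig_ord sumEFin lee_fin; apply: ler_sum => n _.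
rewrite fourier_trigpoly // (bigD1 n) //= eqxx mulr1 big1 ?addr0 // => i ni.
by rewrite (inj_eq injgam) -[_ == _ :> nat]/(i == n) (negbTE ni) mulr0.
Qed.

Lemma sidon_ge1 : 1 <= K.
Proof.
have := @sidon_trigpoly (fun=> 1) 1; rewrite big_ord1 Normc.normc1.
rewrite (_ : supnorm _ = 1) ?mulr1 // /supnorm.
rewrite (_ : [set _ | _ in _] = [set 1]) ?sup1 //.
have n1 x : Normc.normc (trigpoly (fun=> 1) 1 x) = 1.
  by rewrite /trigpoly big_ord1 mul1r; case: (chgam 0%N).
by apply/seteqP; split => [_ [x _ <-] /=|_ -> /=]; [|exists 0].
Qed.

(** The factor 2 makes room for a point that only nearly attains the supremum: were the inequality
    to fail everywhere, the Sidon inequality would give S <= S / 2 with S > 0. *)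
Lemma sidon_attained (b : nat -> R[i]) m : exists x,
  \sum_(n < m) Normc.normc (b n) <= 2 * K * Normc.normc (trigpoly b m x).
Proof.
apply: contrapT => /forallNP H; have K1 := sidon_ge1; set S := \sum_(n < m) _ in H.
have {}H x : 2 * K * Normc.normc (trigpoly b m x) < S.
  by rewrite ltNge; apply/negP; exact: H.
have S0 : 0 < S.
  apply: le_lt_trans (H 0); rewrite mulr_ge0 ?normc_ge0 //; lra.
have : supnorm (trigpoly b m) <= S / (2 * K).
  apply: ge_sup; first by exists (Normc.normc (trigpoly b m 0)), 0.
  move=> _ [x _ <-]; rewrite ler_pdivlMr; last by lra.
  by rewrite mulrC ltW.
have K0 : 0 <= K by lra.
move=> /(ler_wpM2l K0)/(le_trans (sidon_trigpoly b m)); rewrite -/S.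
have -> : K * (S / (2 * K)) = S / 2 by field; apply: lt0r_neq0; lra.
lra.
Qed.

End Orthogonality.

(** * Multipliers of Sidon sets *)

Section SidonMultipliers.
Variables (R : realType) (G : topologicalZmodType).
Variable mu : {measure set borelG G -> \bar R}.
Hypothesis cptG : compact [set: G].
Hypothesis haar : is_normalized_haar mu.
Variable gam : nat -> G -> R[i].
Hypothesis chgam : forall n, is_character (gam n).
Hypothesis injgam : injective gam.
Variable K : R.
Hypothesis sidon : is_Sidon mu (range gam) K.
Implicit Types (a b e s : nat -> R[i]).
Local Notation normc := (@Normc.normc R).

Let K1 : 1 <= K. Proof. exact (sidon_ge1 cptG haar chgam injgam sidon). Qed.

Definition trigmom b m k := mean mu (fun x => normc (trigpoly gam b m x) ^+ (2 * k)).

Lemma trigpoly_pow_continuous b m k :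
  continuous (fun x => normc (trigpoly gam b m x) ^+ k).
Proof.
move=> x; apply: (@continuous_comp _ _ _ (fun x => normc (trigpoly gam b m x))
  (@GRing.exp R ^~ k)); last exact: exprn_continuous.
exact: normc_continuous (trigpoly_continuous chgam b m) x.
Qed.

Let bm b m k :
  bounded_measurable (fun x => normc (trigpoly gam b m x) ^+ k).
Proof.
by apply: bounded_measurable_continuous => //; exact: trigpoly_pow_continuous.
Qed.

Lemma trigmom_ge0 b m k : 0 <= trigmom b m k.
Proof.
rewrite -[leLHS](mean_cst haar); apply: (le_mean haar) => //.
  exact: bounded_measurable_cst.
by move=> x; rewrite exprn_ge0 ?normc_ge0.
Qed.

Section FixedPolynomial.
Variables (a : nat -> R[i]) (m k : nat).

(* Defining the admissible multipliers by the inequality itself avoids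
   representing them as convolutions with measures: the set is convex and
   contains the multiples of point evaluations. *)
Let dominated s :=
  trigmom (fun n => a n * s n) m k <= (2 * K) ^+ (2 * k) * trigmom a m k.

(** Convexity holds pointwise, before integration: the triangle inequality, then [convex_exprn] for
    the power 2k. *)
Lemma dominated_convex (t : R) s s' : 0 <= t <= 1 -> dominated s -> dominated s' ->
  dominated (fun n => ((1 - t)%:C)%C * s n + (t%:C)%C * s' n).
Proof.
move=> /andP[t0 t1] ds ds'; have t1' : 0 <= 1 - t by rewrite subr_ge0.
rewrite /dominated; set B := leRHS.
pose P s x := normc (trigpoly gam (fun n => a n * s n) m x) ^+ (2 * k).
apply: (@le_trans _ _ ((1 - t) * mean mu (P s) + t * mean mu (P s'))); last first.
  have h : mean mu (P s) <= B by exact: ds.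
  have h' : mean mu (P s') <= B by exact: ds'.
  by have := ler_wpM2l t0 h'; have := ler_wpM2l t1' h; lra.
have bP r : bounded_measurable (P r) by exact: bm.
have b1 := bounded_measurableZ (1 - t) (bP s).
have b2 := bounded_measurableZ t (bP s').
rewrite -(meanZ haar (1 - t)) // -(meanZ haar t) // -(meanD haar) //.
apply: (le_mean haar) => //; first exact: bounded_measurableD.
move=> x; have c01 : 0 <= t <= 1 by rewrite t0.
apply: le_trans (convex_exprn _ c01 (normc_ge0 _) (normc_ge0 _)).
apply: lerXn2r; rewrite ?nnegrE ?normc_ge0 ?addr_ge0 ?mulr_ge0 ?normc_ge0 //.
have -> : trigpoly gam (fun n => a n * (((1 - t)%:C)%C * s n + (t%:C)%C * s' n)) m x =
    ((1 - t)%:C)%C * trigpoly gam (fun n => a n * s n) m x +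
    (t%:C)%C * trigpoly gam (fun n => a n * s' n) m x.
  rewrite /trigpoly !mulr_sumr -big_split; apply: eq_bigr => n _ /=.
  by move: (((1 - t)%:C)%C) ((t%:C)%C) => u v; ring.
apply: (le_trans (le_normcD _ _)).
by rewrite !Normc.normcM !normc_real !ger0_norm.
Qed.

(** Up to the scalar [2 * K * c], of modulus at most 2K, this multiplier translates the polynomial
    by [x]. *)
Lemma dominated_point (c : R[i]) (x : G) : normc c <= 1 ->
  dominated (fun n => ((2 * K)%:C)%C * c * gam n x).
Proof.
move=> c1; have K0 : 0 <= 2 * K by have := K1; lra.
have ca := @trigpoly_pow_continuous a m (2 * k).
rewrite /dominated /trigmom -(mean_translation cptG haar x ca).
have bT : bounded_measurable (fun y => normc (trigpoly gam a m (x + y)) ^+ (2 * k)).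
  apply: bounded_measurable_continuous => // y.
  apply: (@continuous_comp _ _ _ (fun y => x + y)
    (fun y => normc (trigpoly gam a m y) ^+ (2 * k))); last exact: ca.
  exact: translation_continuous.
rewrite -(meanZ haar) //; apply: (le_mean haar) => //.
  exact: bounded_measurableZ.
move=> y; have -> : trigpoly gam (fun n => a n * (((2 * K)%:C)%C * c * gam n x)) m y =
    ((2 * K)%:C)%C * c * trigpoly gam a m (x + y).
  rewrite /trigpoly mulr_sumr; apply: eq_bigr => n _.
  by case: (chgam n) => _ -> _; ring.
rewrite !Normc.normcM normc_real ger0_norm // -exprMn.
have w0 : 0 <= normc (trigpoly gam a m (x + y)) by exact: normc_ge0.
apply: lerXn2r; rewrite ?nnegrE; last by rewrite ler_wpM2r // ler_piMr.
  by rewrite !mulr_ge0 ?normc_ge0 //; have := K1; lra.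
by rewrite mulr_ge0.
Qed.

Variable e : nat -> R[i].
Hypothesis e1 : forall n, normc (e n) <= 1.

Let dist2 s := \sum_(n < m) normc (e n - s n) ^+ 2.
Let M : R := m%:R * (1 + 2 * K) ^+ 2.

(* Frank-Wolfe descent: the Sidon inequality supplies, for the current error
   [u], a point evaluation lying beyond [e] in the direction [u]. *)
Lemma dominated_approx j : exists2 s, dominated s & j.+1%:R * dist2 s <= M.
Proof.
have KK := K1.
have pt s : exists2 s', dominated s' & (forall n, normc (e n - s' n) <= 1 + 2 * K) /\
    complex.Re (\sum_(n < m) (((e n - s n)^*)%C * (e n - s' n))) <= 0.
  (* The Sidon inequality is applied to the conjugated error, and the phase [c] makes the value at
     [x] real: the pairing with [s'] is at least the sum of the moduli of [e n - s n], hence at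
     least the real part of the pairing with [e]. *)
  have [x hx] := sidon_attained cptG haar chgam injgam sidon
    (fun n => ((e n - s n)^*)%C) m.
  have [c c1 cx] := phasec (trigpoly gam (fun n => ((e n - s n)^*)%C) m x).
  exists (fun n => ((2 * K)%:C)%C * c * gam n x); first exact: dominated_point.
  split=> [n|].
    apply: (le_trans (le_normcD _ _)); rewrite normcN !Normc.normcM normc_real.
    case: (chgam n) => _ _ ->; rewrite mulr1 ger0_norm; last by lra.
    by apply: lerD; rewrite // ler_piMr //; lra.
  have -> : \sum_(n < m) ((e n - s n)^*)%C * (e n - ((2 * K)%:C)%C * c * gam n x) =
    \sum_(n < m) ((e n - s n)^*)%C * e n -
    ((2 * K)%:C)%C * (c * trigpoly gam (fun n => ((e n - s n)^*)%C) m x).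
    rewrite /trigpoly !mulr_sumr -sumrB; apply: eq_bigr => n _ /=; ring.
  rewrite cx -rmorphM ReD /=.
  rewrite subr_le0; apply: le_trans hx; apply: (le_trans (Re_le_normc _)).
  apply: (le_trans (normc_sum m (fun n => ((e n - s n)^*)%C * e n))).
  apply: ler_sum => n _; rewrite Normc.normcM.
  by rewrite ler_piMr // normc_ge0.
have dM s' : (forall n, normc (e n - s' n) <= 1 + 2 * K) -> dist2 s' <= M.
  move=> h; rewrite /M -[m in leRHS]card_ord -sumr_const.
  rewrite mulr_suml; apply: ler_sum => n _; rewrite mul1r.
  by apply: lerXn2r; rewrite ?nnegrE ?normc_ge0 ?h //; lra.
elim: j => [|j [s ds IH]].
  by have [s' ds' [/dM h _]] := pt (fun=> 0); exists s'; rewrite ?mul1r.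
have [s' ds' [/dM h hR]] := pt s.
(* With this step the induction closes: if D and D' are the old and new errors, (j + 2) D' <= ((j +
   1)^2 D + M) / (j + 2) <= M, because (j + 1) D <= M. *)
pose t : R := j.+2%:R^-1.
have j2 : 1 <= j.+2%:R :> R by rewrite ler1n.
have j0 : 0 < j.+2%:R :> R by lra.
have t0 : 0 <= t by rewrite invr_ge0 ltW.
have t1 : t <= 1 by rewrite invf_le1.
exists (fun n => ((1 - t)%:C)%C * s n + (t%:C)%C * s' n).
  by apply: dominated_convex => //; rewrite t0.
have -> : dist2 (fun n => ((1 - t)%:C)%C * s n + (t%:C)%C * s' n) =
    (1 - t) ^+ 2 * dist2 s +
    2 * t * (1 - t) * complex.Re (\sum_(n < m) (((e n - s n)^*)%C * (e n - s' n))) +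
    t ^+ 2 * dist2 s'.
  rewrite (Re_sum m (fun n => ((e n - s n)^*)%C * (e n - s' n))).
  rewrite /dist2 !mulr_sumr -!big_split; apply: eq_bigr => n _ /=.
  rewrite -normc_sqr_convex; congr (normc _ ^+ 2).
  have -> : ((1 - t)%:C)%C = 1 - (t%:C)%C :> R[i] by rewrite rmorphB.
  by ring.
have {}hR : 2 * t * (1 - t) *
    complex.Re (\sum_(n < m) (((e n - s n)^*)%C * (e n - s' n))) <= 0.
  by rewrite mulr_ge0_le0 // !mulr_ge0 // subr_ge0.
apply: (@le_trans _ _ (j.+2%:R * ((1 - t) ^+ 2 * dist2 s + t ^+ 2 * M))).
  rewrite ler_wpM2l ?ler0n //.
  by have := ler_wpM2l (sqr_ge0 t) h; lra.
have -> : j.+2%:R * ((1 - t) ^+ 2 * dist2 s + t ^+ 2 * M) =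
    (j.+1%:R * (j.+1%:R * dist2 s) + M) / j.+2%:R.
  rewrite /t -[j.+2%:R]natr1; field.
  by apply: lt0r_neq0; have := ler0n R j; have := ler0n R j.+1; lra.
rewrite ler_pdivrMr //.
have := ler_wpM2l (ler0n R j.+1) IH; rewrite -[j.+2%:R]natr1; lra.
Qed.

(** [e] is only approximated by dominated multipliers [s]. Splitting it as s + (e - s) and using (x
    + y)^2k <= 2^2k (x^2k + y^2k) turns 2K into 4K and leaves an error that tends to 0 with the
    distance. *)
Lemma sidon_multiplier : (0 < k)%N ->
  trigmom (fun n => a n * e n) m k <= (4 * K) ^+ (2 * k) * trigmom a m k.
Proof.
move=> k0; have KK := K1.
pose A := \sum_(n < m) normc (a n).
have A0 : 0 <= A by apply: sumr_ge0 => n _; exact: normc_ge0.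
have M0 : 0 <= M by rewrite mulr_ge0 ?ler0n ?sqr_ge0.
pose Q := A ^+ 2 * M.
have Q0 : 0 <= Q by rewrite mulr_ge0 ?sqr_ge0.
have step j : Q / j.+1%:R <= 1 ->
    trigmom (fun n => a n * e n) m k <=
    (4 * K) ^+ (2 * k) * trigmom a m k + 2 ^+ (2 * k) * (Q / j.+1%:R).
  set q := Q / _ => q1.
  have q0 : 0 <= q by rewrite divr_ge0 ?ler0n.
  have [s ds hs] := dominated_approx j.
  pose F x := normc (trigpoly gam (fun n => a n * s n) m x) ^+ (2 * k).
  have bF : bounded_measurable F by exact: bm.
  pose H x := 2 ^+ (2 * k) * F x + 2 ^+ (2 * k) * q.
  have b1 := bounded_measurableZ (2 ^+ (2 * k)) bF.
  have b2 := @bounded_measurable_cst R G (2 ^+ (2 * k) * q).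
  apply: (@le_trans _ _ (mean mu H)); last first.
    rewrite /H (meanD haar) // (meanZ haar) // (mean_cst haar) lerD2r.
    have -> : 4 * K = 2 * (2 * K) by ring.
    by rewrite exprMn -mulrA ler_wpM2l // exprn_ge0.
  apply: (le_mean haar) => //; first exact: bounded_measurableD.
  move=> x; rewrite /H /F.
  pose y := normc (trigpoly gam (fun n => a n * (e n - s n)) m x).
  have y0 : 0 <= y by exact: normc_ge0.
  have yA : y ^+ 2 <= q.
    have es n : (n < m)%N -> normc (e n - s n) <= Num.sqrt (dist2 s).
      move=> nm; rewrite -[leLHS]ger0_norm ?normc_ge0 // -sqrtr_sqr ler_wsqrtr //.
      rewrite /dist2 (bigD1 (Ordinal nm)) //= lerDl.
      by apply: sumr_ge0 => i _; exact: sqr_ge0.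
    have D0 : 0 <= dist2 s by apply: sumr_ge0 => i _; exact: sqr_ge0.
    have : y <= A * Num.sqrt (dist2 s).
      apply: (le_trans (normc_sum m (fun n => a n * (e n - s n) * gam n x))).
      rewrite mulr_suml; apply: ler_sum => n _; rewrite !Normc.normcM.
      case: (chgam n) => _ _ ->; rewrite mulr1.
      by rewrite ler_wpM2l ?normc_ge0 ?es.
    move=> yle; have AS0 : 0 <= A * Num.sqrt (dist2 s) by rewrite mulr_ge0 ?sqrtr_ge0.
    apply: (le_trans (lerXn2r 2 y0 AS0 yle)); rewrite exprMn sqr_sqrtr //.
    rewrite /q /Q -mulrA ler_wpM2l ?sqr_ge0 //.
    by rewrite ler_pdivlMr ?ltr0n // mulrC.
  have yk : y ^+ (2 * k) <= q.
    rewrite exprM; apply: (@le_trans _ _ (q ^+ k)).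
      by apply: lerXn2r; rewrite ?nnegrE ?sqr_ge0.
    by rewrite -[leRHS]expr1; apply: ler_wiXn2l.
  rewrite -mulrDr.
  have -> : trigpoly gam (fun n => a n * e n) m x =
      trigpoly gam (fun n => a n * s n) m x + trigpoly gam (fun n => a n * (e n - s n)) m x.
    by rewrite /trigpoly -big_split; apply: eq_bigr => n _ /=; ring.
  apply: (@le_trans _ _ ((normc (trigpoly gam (fun n => a n * s n) m x) + y) ^+ (2 * k))).
    by apply: lerXn2r; rewrite ?nnegrE ?addr_ge0 ?normc_ge0 // le_normcD.
  apply: (le_trans (ler_exprDn _ (normc_ge0 _) y0)).
  rewrite ler_wpM2l ?exprn_ge0 // ler_pdivrMr // mulrDl.
  apply: lerD; first by rewrite ler_peMr ?exprn_ge0 ?normc_ge0 // ler1n.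
  by apply: (le_trans yk); rewrite ler_peMr // ler1n.
apply/ler_addgt0Pr => eps eps0.
have P0 : 0 < 2 ^+ (2 * k) :> R by rewrite exprn_gt0.
(* The bound by 1 gives q^k <= q for the error q, as k > 0; the other bound keeps its contribution
   below [eps]. *)
pose d := Num.min 1 (eps / 2 ^+ (2 * k)).
have d0 : 0 < d by rewrite lt_min ltr01 divr_gt0.
have := archi_boundP (divr_ge0 Q0 (ltW d0)); set j := Num.bound _ => hj.
have hq : Q / j.+1%:R <= d.
  rewrite ler_pdivrMr ?ltr0n // mulrC -ler_pdivrMr //.
  by apply: (le_trans (ltW hj)); rewrite ler_nat.
have /andP[hq1 hq2] : (Q / j.+1%:R <= 1) && (Q / j.+1%:R <= eps / 2 ^+ (2 * k)).
  by rewrite -le_min.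
apply: (le_trans (step j hq1)); rewrite lerD2l.
by rewrite mulrC -ler_pdivlMr.
Qed.

End FixedPolynomial.

End SidonMultipliers.

(** * Moments of character sums against moments of Rademacher sums *)

Section SidonMoments.
Variables (R : realType) (G : topologicalZmodType).
Variable mu : {measure set borelG G -> \bar R}.
Hypothesis cptG : compact [set: G].
Hypothesis haar : is_normalized_haar mu.
Variable gam : nat -> G -> R[i].
Hypothesis chgam : forall n, is_character (gam n).
Hypothesis injgam : injective gam.
Variable K : R.
Hypothesis sidon : is_Sidon mu (range gam) K.
Variables (a : nat -> R) (m k : nat).
Hypothesis k0 : (0 < k)%N.

Let twisted s : nat -> R[i] := fun n => ((a n)%:C)%C * ((s`_n)%:C)%C.
Let moment s := trigmom mu gam (twisted s) m k.
Let coef : nat -> R[i] := fun n => ((a n)%:C)%C.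
Let K1 : 1 <= K. Proof. exact (sidon_ge1 cptG haar chgam injgam sidon). Qed.
Let K4 : 0 <= (4 * K) ^+ (2 * k).
Proof. by rewrite exprn_ge0 //; have := K1; lra. Qed.

Let sign_le1 s : size s = m -> signs s -> forall n, (@Normc.normc R ((s`_n)%:C)%C) <= 1.
Proof.
move=> sm ss n; rewrite normc_real; have [ns|sn] := ltnP n (size s).
  by rewrite -ler_sqr ?nnegrE // real_normK ?num_real // signs_sqr // expr1n.
by rewrite nth_default // normr0.
Qed.

Lemma bounded_measurable_sgn_mean (F : seq R -> G -> R) :
  (forall s, bounded_measurable (F s)) ->
  bounded_measurable (fun x => sgn_mean m (F^~ x)) /\
  mean mu (fun x => sgn_mean m (F^~ x)) = sgn_mean m (fun s => mean mu (F s)).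
Proof.
elim: m F => [|n IH] F bF /=; first by split=> //; exact: bF.
have [b1 e1] := IH (fun s => F (1 :: s)) (fun s => bF _).
have [b2 e2] := IH (fun s => F (- 1 :: s)) (fun s => bF _).
have -> : (fun x => (sgn_mean n (fun s => F (1 :: s) x) +
    sgn_mean n (fun s => F (-1 :: s) x)) / 2) =
  (fun x => 2^-1 * (sgn_mean n (fun s => F (1 :: s) x) +
    sgn_mean n (fun s => F (-1 :: s) x))) by apply/funext => x; rewrite mulrC.
have b := bounded_measurableD b1 b2.
split; first exact: bounded_measurableZ.
by rewrite (meanZ haar) // (meanD haar) // e1 e2 mulrC.
Qed.

Let rs2 (x : G) := rsum2 a (fun n => complex.Re (gam n x)) (fun n => complex.Im (gam n x)) m.

Let Re2Im2 x n : complex.Re (gam n x) ^+ 2 + complex.Im (gam n x) ^+ 2 = 1.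
Proof. by rewrite -normc_sqr; case: (chgam n) => _ _ ->; rewrite expr1n. Qed.

Let normc_twisted s x :
  Normc.normc (trigpoly gam (twisted s) m x) ^+ (2 * k) = rs2 x s ^+ k.
Proof.
rewrite exprM normc_sqr /rs2 /rsum2 /trigpoly.
rewrite (Re_sum m (fun n => twisted s n * gam n x)).
rewrite (Im_sum m (fun n => twisted s n * gam n x)).
by congr ((_ ^+ 2 + _ ^+ 2) ^+ k); apply: eq_bigr => n _; rewrite /twisted;
  case: (gam n x) => u v /=; ring.
Qed.

Let avg : bounded_measurable (fun x => sgn_mean m (fun s => rs2 x s ^+ k)) /\
  mean mu (fun x => sgn_mean m (fun s => rs2 x s ^+ k)) = sgn_mean m moment.
Proof.
pose F s x := Normc.normc (trigpoly gam (twisted s) m x) ^+ (2 * k).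
have bF s : bounded_measurable (F s).
  by apply: bounded_measurable_continuous => //; exact: trigpoly_pow_continuous.
have [bsF <-] := bounded_measurable_sgn_mean bF.
have <- : (fun x => sgn_mean m (F^~ x)) =
    (fun x => sgn_mean m (fun s => rs2 x s ^+ k)).
  by apply/funext => x; apply: eq_sgn_mean => s _ _; exact: normc_twisted.
by [].
Qed.

(** [le_sgn_mean_unimodular] holds at every point; integrated over G, it bounds [rmom] by the
    average of the moments of the sign-twisted polynomials, and [sidon_multiplier] bounds each of
    these. Since 4^k = 2^2k, 4K becomes 8K. *)
Lemma rmom_le_trigmom :
  rmom a m k <= (8 * K) ^+ (2 * k) * trigmom mu gam coef m k.
Proof.
have [bavg eavg] := avg.
apply: (@le_trans _ _ (4 ^+ k * sgn_mean m moment)).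
  rewrite -eavg -[leLHS](mean_cst haar) -(meanZ haar) //.
  apply: (le_mean haar) => //; first exact: bounded_measurable_cst.
    exact: bounded_measurableZ.
  by move=> x; apply: le_sgn_mean_unimodular.
have -> : (8 * K) ^+ (2 * k) = 4 ^+ k * (4 * K) ^+ (2 * k).
  have -> : 8 * K = 2 * (4 * K) by ring.
  by rewrite [LHS]exprMn [2 ^+ (2 * k)]exprM -natrX.
rewrite -mulrA ler_wpM2l ?exprn_ge0 //.
rewrite -[leRHS](sgn_mean_cst m); apply: le_sgn_mean => s sm ss.
exact: (sidon_multiplier cptG haar chgam injgam sidon _ _ (sign_le1 sm ss) k0).
Qed.

Lemma trigmom_le_rmom :
  trigmom mu gam coef m k <= (8 * K) ^+ (2 * k) * rmom a m k.
Proof.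
have [bavg eavg] := avg.
apply: (@le_trans _ _ ((4 * K) ^+ (2 * k) * sgn_mean m moment)).
  rewrite -sgn_meanZ -[leLHS](sgn_mean_cst m); apply: le_sgn_mean => s sm ss.
  (* Twisting twice by the same signs is the identity, so the untwisted polynomial is a sign
     multiple of each twisted one. *)
  have -> : trigmom mu gam coef m k =
      trigmom mu gam (fun n => twisted s n * ((s`_n)%:C)%C) m k.
    congr mean; apply/funext => x; congr (Normc.normc _ ^+ _).
    apply: eq_bigr => n _; rewrite /twisted -[_ * _ * ((s`_n)%:C)%C]mulrA -rmorphM -expr2.
    by rewrite signs_sqr ?sm // mulr1.
  exact: (sidon_multiplier cptG haar chgam injgam sidon _ _ (sign_le1 sm ss) k0).
apply: (@le_trans _ _ ((4 * K) ^+ (2 * k) * (2 ^+ k * rmom a m k))).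
  rewrite ler_wpM2l // -eavg -[leRHS](mean_cst haar).
  apply: (le_mean haar) => //; first exact: bounded_measurable_cst.
  by move=> x; apply: sgn_mean_unimodular_le.
rewrite mulrA ler_wpM2r ?rmom_ge0 //.
have -> : 8 * K = (4 * K) * 2 by ring.
rewrite [leRHS]exprMn ler_wpM2l // ler_eXn2l ?ltr1n //.
by rewrite leq_pmull.
Qed.

End SidonMoments.

Theorem theorem2p10 (R : realType) (K : R) :
  exists C : R, forall (G : topologicalZmodType)
    (mu : {measure set borelG G -> \bar R}) (gam : nat -> G -> R[i]),
    compact [set: G] -> hausdorff_space G ->
    is_normalized_haar mu ->
    (forall n, is_character (gam n)) -> injective gam ->
    is_Sidon mu (range gam) K ->
    equiv_rademacher mu gam C.
Proof.
(* [A] is the constant of the moment comparison. [B] has to be a doubling constant for both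
   variables: it is 2 for Rademacher sums, and passing to characters and back multiplies it by A^2.
   [C] is the constant of [tail_compare]. *)
pose A := 8 * K; pose B := 2 * A ^+ 2; pose C := 4 * B ^+ 4 + 2 * A * B ^+ 3.
exists C => G mu gam cptG _ haar chgam injgam sidon.
have K1 := sidon_ge1 cptG haar chgam injgam sidon.
have A1 : 1 <= A by rewrite /A; lra.
have A21 : 1 <= A ^+ 2 by exact: exprn_ege1.
have B2 : 2 <= B by rewrite /B; lra.
have C0 : 0 < C.
  by rewrite addr_gt0 // !mulr_gt0 ?exprn_gt0 //; lra.
split=> // m a z z0; rewrite rademacher_tail //.
set P := fun x : R => sgn_mean m (fun s => (x < `|rsum a m s|)%R%:R).
set S := fun x : G => Normc.normc (\sum_(n < m) ((a n)%:C)%C * gam n x).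
pose PG (x : R) := fine (mu [set y | x < S y]).
have cS : continuous S.
  exact: normc_continuous (trigpoly_continuous chgam (fun n => (a n)%:C)%C m).
have muE (x : R) : mu [set y | (x < S y)%R] = (PG x)%:E.
  have mA : measurable ([set y | (x < S y)%R] : set (borelG G)).
    have := measurable_continuous cS measurableT (measurable_itv `]x, +oo[%R).
    rewrite setTI; congr measurable; apply/seteqP.
    by split => y; rewrite /= in_itv /= andbT.
  rewrite /PG fineK // ge0_fin_numE //.
  apply: le_lt_trans (_ : mu setT < +oo)%E; first by apply: le_measure; rewrite ?inE.
  by case: haar => -> _ _; rewrite ltry.
have tP : tail_moment P (rmom a m) := tail_moment_sgn a m.
have tG : tail_moment PG (trigmom mu gam (fun n => (a n)%:C)%C m).
  by apply: tail_moment_mean => // x; exact: normc_ge0.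
have MG k : (0 < k)%N -> trigmom mu gam (fun n => (a n)%:C)%C m k <=
    A ^+ (2 * k) * rmom a m k.
  exact: (trigmom_le_rmom cptG haar chgam injgam sidon a m).
have MR k : (0 < k)%N -> rmom a m k <=
    A ^+ (2 * k) * trigmom mu gam (fun n => (a n)%:C)%C m k.
  exact: (rmom_le_trigmom cptG haar chgam injgam sidon a m).
have R2 k : (0 < k)%N -> rmom a m (k + k)%N <= B ^+ (4 * k) * rmom a m k ^+ 2.
  move=> _; apply: (le_trans (rmom_double a m k)).
  rewrite ler_wpM2r ?sqr_ge0 //; apply: lerXn2r; rewrite ?nnegrE //; lra.
have G2 k : (0 < k)%N -> trigmom mu gam (fun n => (a n)%:C)%C m (k + k)%N <=
    B ^+ (4 * k) * trigmom mu gam (fun n => (a n)%:C)%C m k ^+ 2.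
  move=> k0; have A0 : 0 <= A by lra.
  have MG0 := trigmom_ge0 cptG haar chgam (fun n => (a n)%:C)%C m k.
  have kk : (2 * (k + k) = 4 * k)%N by rewrite addnn -mul2n mulnA.
  apply: (le_trans (MG _ (ltn_addl k k0))); rewrite kk.
  apply: (le_trans (ler_wpM2l _ (rmom_double a m k))); first by rewrite exprn_ge0.
  have sq := lerXn2r 2 (rmom_ge0 a m k) (mulr_ge0 (exprn_ge0 _ A0) MG0) (MR k k0).
  apply: (@le_trans _ _ (A ^+ (4 * k) * (2 ^+ (4 * k) *
    (A ^+ (2 * k) * trigmom mu gam (fun n => (a n)%:C)%C m k) ^+ 2))).
    by rewrite !ler_wpM2l ?exprn_ge0.
  rewrite [(A ^+ _ * _) ^+ 2]exprMn -[A ^+ _ ^+ 2]exprM mulnAC.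
  rewrite !mulrA ler_wpM2r ?sqr_ge0 // /B -!exprMn.
  by rewrite [A * 2]mulrC -mulrA -expr2.
(* Both inequalities are [tail_compare] with the two variables exchanged; the first is taken at
   level [C * z]. *)
split.
  rewrite muE -EFinM lee_fin ler_pdivrMl //.
  have := tail_compare tP tG A1 B2 MG R2 (mulr_gt0 C0 z0) (erefl C).
  by rewrite [C * z / C]mulrAC divff ?mul1r // gt_eqF.
rewrite muE -EFinM lee_fin [C^-1 * z]mulrC.
exact: (tail_compare tG tP A1 B2 MR G2 z0 (erefl C)).
Qed.
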